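(* Let $\mathbf Q_{\mathrm{rb}}(\boldsymbol\mu)$ be the Taylor reduced basis approximation of order $n\in\mathbb N_0$ of the total eigenprojector $\mathbf P(\boldsymbol\mu)$ of the first $K$ distinct eigenvalues, and let $\boldsymbol\Pi_n$, $\mathrm{Res}^2(\boldsymbol\mu,\boldsymbol\Pi_n)$, $\gamma(\boldsymbol\mu)$, $P_{n+1}$ be as defined in the context. Then, for $\boldsymbol\mu$ close to $\boldsymbol\mu_0$, $$\|\mathbf Q_{\mathrm{rb}}(\boldsymbol\mu)-\mathbf P(\boldsymbol\mu)\|\le\sqrt{1+\frac{\mathrm{Res}^2(\boldsymbol\mu,\boldsymbol\Pi_n)}{\gamma(\boldsymbol\mu)^2}}\;\|\boldsymbol\Pi_n^\perp\mathbf P(\boldsymbol\mu)\|.$$ In particular, we have the asymptotic estimate $$\|\mathbf Q_{\mathrm{rb}}(\boldsymbol\mu)-\mathbf P(\boldsymbol\mu)\|=\mathcal O\big(|\boldsymbol\mu-\boldsymbol\mu_0|^{n+1}\big)\quad\text{as }\boldsymbol\mu\to\boldsymbol\mu_0,$$ and the coefficient of the leading error term is given by $$\sqrt{1+\frac{\mathrm{Res}^2(\boldsymbol\mu_0,\boldsymbol\Pi_n)}{\gamma(\boldsymbol\mu_0)^2}}\;P_{n+1}(0),\qquad\text{where } P_{n+1}(0)=\sum_{|\boldsymbol\beta|=n+1}\|\mathbf P^{(\boldsymbol\beta)}\|.$$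
   Context: $\mathcal P\subseteq\mathbb R^d$ is open, $\boldsymbol\mu_0\in\mathcal P$, and $\mathbf A:\mathcal P\to\mathbb C^{N\times N}$ is Hermitian-matrix-valued and real-analytic (locally equal to its convergent multivariate power series). Multi-index notation: $|\boldsymbol\beta|=\beta_1+\dots+\beta_d$, $\boldsymbol\mu^{\boldsymbol\beta}=\mu_1^{\beta_1}\cdots\mu_d^{\beta_d}$; $|\boldsymbol\mu|$ is the Euclidean norm for $\boldsymbol\mu\in\mathbb R^d$; $\|\cdot\|$ is the spectral norm; $\sigma(\cdot)$ is the spectrum; $\mathbf E^\perp:=\mathbf I-\mathbf E$ for an orthogonal projector $\mathbf E=\mathbf E^2=\mathbf E^*$; $\mathbf A\!\upharpoonright_{\mathbf E}(\boldsymbol\mu):\operatorname{ran}\mathbf E\to\operatorname{ran}\mathbf E$, $\mathbf y\mapsto\mathbf E\mathbf A(\boldsymbol\mu)\mathbf y$. $\lambda_1<\dots<\lambda_K<\lambda_{K+1}<\cdots$ are the distinct eigenvalues of $\mathbf A(\boldsymbol\mu_0)$ in increasing order, with multiplicities $m_1,m_2,\dots$, and $M:=m_1+\dots+m_K$. For $\boldsymbol\mu$ near $\boldsymbol\mu_0$, $\mathbf P(\boldsymbol\mu)$ is the analytic orthogonal-projector-valued function of rank $M$ commuting with $\mathbf A(\boldsymbol\mu)$ such that $\mathbf P(\boldsymbol\mu_0)$ projects onto the sum of the eigenspaces of $\lambda_1,\dots,\lambda_K$; i.e. $\mathbf P(\boldsymbol\mu)=\frac{-1}{2\pi i}\oint(\mathbf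 A(\boldsymbol\mu)-\zeta\mathbf I)^{-1}d\zeta$ over a contour enclosing exactly $\lambda_1,\dots,\lambda_K$ among the eigenvalues of $\mathbf A(\boldsymbol\mu_0)$. Write $\mathbf P(\boldsymbol\mu)=\sum_{\boldsymbol\beta\in\mathbb N_0^d}(\boldsymbol\mu-\boldsymbol\mu_0)^{\boldsymbol\beta}\mathbf P^{(\boldsymbol\beta)}$ and $P_{n+1}(x):=\sum_{p=0}^\infty x^p\big(\sum_{|\boldsymbol\beta|=p+n+1}\|\mathbf P^{(\boldsymbol\beta)}\|\big)$. The Taylor reduced basis space of order $n$ is $\mathcal V_n:=\operatorname{span}\{\operatorname{ran}\mathbf P^{(\boldsymbol\beta)}:|\boldsymbol\beta|\le n\}\subseteq\mathbb C^N$, with orthogonal projector $\boldsymbol\Pi_n$ onto it. The Taylor reduced basis approximation $\mathbf Q_{\mathrm{rb}}(\boldsymbol\mu)$ is the minimizer of $\operatorname{tr}(\mathbf A(\boldsymbol\mu)\mathbf M)$ over all $\mathbf M=\mathbf M^2=\mathbf M^*\in\mathbb C^{N\times N}$ with $\operatorname{tr}\mathbf M=M$ and $\operatorname{ran}\mathbf M\subseteq\mathcal V_n$; it is unique for $\boldsymbol\mu$ in a small neighborhood of $\boldsymbol\mu_0$. $\mathrm{Res}^2(\boldsymbol\mu,\boldsymbol\Pi_n):=\|\boldsymbol\Pi_n\mathbf A(\boldsymbol\mu)\boldsymbol\Pi_n^\perp\|^2$ and $$\gamma(\boldsymbol\mu):=\min\big\{|\lambda-\hat\lambda|:\lambda\in\sigma\big(\mathbf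 A\!\upharpoonright_{\mathbf P(\boldsymbol\mu)}(\boldsymbol\mu)\big),\ \hat\lambda\in\sigma\big(\mathbf A\!\upharpoonright_{\boldsymbol\Pi_n\mathbf Q_{\mathrm{rb}}^\perp(\boldsymbol\mu)}(\boldsymbol\mu)\big)\big\},$$ which is positive and continuous in a neighborhood of $\boldsymbol\mu_0$. *)

(* Defs.v *)
From HB Require Import structures.
From mathcomp Require Import all_boot all_order all_algebra.
From mathcomp Require Import complex.
From mathcomp Require Import all_classical all_reals all_analysis.

Set Implicit Arguments.
Unset Strict Implicit.
Unset Printing Implicit Defensive.

Import Order.TTheory GRing.Theory Num.Theory.
Import numFieldNormedType.Exports.
Import ComplexField.Normc.

Local Open Scope classical_set_scope.
Local Open Scope ring_scope.
Local Open Scope complex_scope.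
Local Open Scope sesquilinear_scope.

(* MathComp's norm on 'rV[R]_d is the max norm, hence an explicit Euclidean
   norm; the two induce the same neighborhoods. *)
Definition enorm (R : realType) (d : nat) (x : 'rV[R]_d) : R :=
  Num.sqrt (\sum_i x 0 i ^+ 2).

Definition cvnorm (R : realType) (N : nat) (y : 'cV[R[i]]_N) : R :=
  Num.sqrt (\sum_i normc (y i 0) ^+ 2).

Definition spnorm (R : realType) (N : nat) (X : 'M[R[i]]_N) : R :=
  sup [set cvnorm (X *m y) | y in [set y | cvnorm y <= 1]].

(* The multi-indices beta in N_0^d with |beta| = p: all their entries are at
   most p, so they are enumerated through the functions 'I_d -> 'I_p.+1. *)
Definition mindex (d p : nat) : seq {ffun 'I_d -> nat} :=
  [seq [ffun i => b i : nat]
     | b : {ffun 'I_d -> 'I_p.+1} <- enum {: {ffun 'I_d -> 'I_p.+1}}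
     & (\sum_i b i == p)%N].

Lemma mem_mindex d p (b : {ffun 'I_d -> nat}) : (b \in mindex d p) = (\sum_i b i == p)%N.
Proof.
apply/mapP/eqP => [[c]|H].
  rewrite mem_filter => /andP[/eqP h _ ->].
  by apply: etrans h; apply: eq_bigr => i _; rewrite ffunE.
have h i : (b i < p.+1)%N by rewrite ltnS -H (bigD1 i) //= leq_addr.
exists [ffun i => Ordinal (h i)]; last by apply/ffunP => i; rewrite !ffunE.
rewrite mem_filter mem_enum andbT; apply/eqP; rewrite -[RHS]H.
by apply: eq_bigr => i _; rewrite ffunE.
Qed.
Lemma uniq_mindex d p : uniq (mindex d p).
Proof.
rewrite map_inj_uniq ?filter_uniq ?enum_uniq -?enumT ?enum_uniq // => x y /ffunP h.
by apply/ffunP => i; apply: val_inj; have := h i; rewrite !ffunE.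
Qed.

Definition mpow (R : realType) (d : nat) (x : 'rV[R]_d)
    (beta : {ffun 'I_d -> nat}) : R :=
  \prod_i x 0 i ^+ beta i.

(* On a ball around mu1 the multivariate power series with coefficients c
   converges absolutely, and its sum is f. Absolute convergence makes the
   order of summation (here by total degree) irrelevant. *)
Definition power_series_at (R : realType) (d N : nat)
    (f : 'rV[R]_d -> 'M[R[i]]_N) (mu1 : 'rV[R]_d)
    (c : {ffun 'I_d -> nat} -> 'M[R[i]]_N) : Prop :=
  exists2 r : R, 0 < r & forall mu : 'rV[R]_d, enorm (mu - mu1) < r ->
    cvgn (series (fun p : nat => \sum_(beta <- mindex d p)
                    `|mpow (mu - mu1) beta| * spnorm (c beta))) /\
    (fun k : nat => spnorm (f mu - \sum_(0 <= p < k)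
         \sum_(beta <- mindex d p) (mpow (mu - mu1) beta)%:C *: c beta))
      @ \oo --> (0 : R).

Definition analytic_at (R : realType) (d N : nat)
    (f : 'rV[R]_d -> 'M[R[i]]_N) (mu : 'rV[R]_d) : Prop :=
  exists c, power_series_at f mu c.

Definition orthoproj (R : realType) (N : nat) (E : 'M[R[i]]_N) : Prop :=
  E *m E = E /\ E \is hermsymmx.

Definition perpmx (R : realType) (N : nat) (E : 'M[R[i]]_N) : 'M[R[i]]_N :=
  1%:M - E.

(* Matrices act on column vectors, whereas MathComp subspaces are row spaces.
   A subspace of C^N is therefore represented by the row space of its
   transposed vectors: ran E is E^T, and the eigenspace {y | B y = a y} is
   eigenspace B^T a. *)

Definition distinct_eigenvalues (R : realType) (N : nat) (B : 'M[R[i]]_N)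
    (lam : seq R) : Prop :=
  sorted <%R lam /\
  forall a : R[i], eigenvalue B^T a = (a \in [seq l%:C | l <- lam]).

Definition first_eigenspaces (R : realType) (N : nat) (B : 'M[R[i]]_N)
    (lam : seq R) (K : nat) : 'M[R[i]]_N :=
  (\sum_(j < K) eigenspace B^T (lam`_j)%:C)%MS.

Definition total_mult (R : realType) (N : nat) (B : 'M[R[i]]_N)
    (lam : seq R) (K : nat) : nat :=
  (\sum_(j < K) \rank (eigenspace B^T (lam`_j)%:C))%N.

Definition total_eigenprojector (R : realType) (d N : nat)
    (A : 'rV[R]_d -> 'M[R[i]]_N) (mu0 : 'rV[R]_d) (lam : seq R) (K : nat)
    (P : 'rV[R]_d -> 'M[R[i]]_N) : Prop :=
  ((P mu0)^T :=: first_eigenspaces (A mu0) lam K)%MS /\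
  \forall mu \near mu0,
    [/\ analytic_at P mu, orthoproj (P mu),
        \rank (P mu) = total_mult (A mu0) lam K
      & A mu *m P mu = P mu *m A mu].

Definition taylor_space (R : realType) (d N : nat)
    (Pc : {ffun 'I_d -> nat} -> 'M[R[i]]_N) (n : nat) : 'M[R[i]]_N :=
  (\sum_(p < n.+1) \sum_(beta <- mindex d p) <<(Pc beta)^T>>)%MS.

Definition orthoproj_onto (R : realType) (N : nat) (E V : 'M[R[i]]_N) : Prop :=
  orthoproj E /\ (E^T :=: V)%MS.

Definition rb_admissible (R : realType) (N : nat) (V : 'M[R[i]]_N) (m : nat)
    (X : 'M[R[i]]_N) : Prop :=
  [/\ orthoproj X, \tr X = m%:R & (X^T <= V)%MS].

(* For Hermitian B the traces are real, and the order of R[i] restricts to the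
   usual one on the reals. *)
Definition rb_minimizer (R : realType) (N : nat) (B V : 'M[R[i]]_N) (m : nat)
    (Q : 'M[R[i]]_N) : Prop :=
  rb_admissible V m Q /\
  forall X, rb_admissible V m X -> \tr (B *m Q) <= \tr (B *m X).

(* The spectrum of y |-> E B y on ran E, for a projector E. *)
Definition restr_spectrum (R : realType) (N : nat) (E B : 'M[R[i]]_N) :
    set R[i] :=
  [set a | exists y : 'cV[R[i]]_N,
     [/\ y != 0, E *m y = y & E *m (B *m y) = a *: y]].

Definition res2 (R : realType) (N : nat) (B Pi : 'M[R[i]]_N) : R :=
  spnorm (Pi *m B *m perpmx Pi) ^+ 2.

(* The sets are finite, so the infimum is a minimum, except that the second
   spectrum is empty when Pi = Q. The minimum over the empty set is +oo, and
   then Res^2 / gamma^2 = 0 below. *)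
Definition spectral_gap (R : realType) (N : nat) (B P Pi Q : 'M[R[i]]_N) :
    \bar R :=
  ereal_inf [set (normc (a - b))%:E | a in restr_spectrum P B
                                    & b in restr_spectrum (Pi *m perpmx Q) B].

Definition rb_factor (R : realType) (N : nat) (B P Pi Q : 'M[R[i]]_N) : R :=
  Num.sqrt (1 + fine ((res2 B Pi)%:E / spectral_gap B P Pi Q ^+ 2)%E).

Definition coef_norm_sum (R : realType) (d N : nat)
    (Pc : {ffun 'I_d -> nat} -> 'M[R[i]]_N) (p : nat) : R :=
  \sum_(beta <- mindex d p) spnorm (Pc beta).

(* tail_series Pc n.+1 is the function P_{n+1}. *)
Definition tail_series (R : realType) (d N : nat)
    (Pc : {ffun 'I_d -> nat} -> 'M[R[i]]_N) (m : nat) (x : R) : R :=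
  limn (series (fun p : nat => x ^+ p * coef_norm_sum Pc (p + m))).

(* Main.v *)
Require Import Defs.
From HB Require Import structures.
From mathcomp Require Import all_boot all_order all_algebra.
From mathcomp Require Import complex.
From mathcomp Require Import all_classical all_reals all_analysis.
From mathcomp Require Import ring lra.

Import Order.TTheory GRing.Theory Num.Theory.
Import numFieldNormedType.Exports.
Import ComplexField.Normc.

Local Open Scope classical_set_scope.
Local Open Scope ring_scope.
Local Open Scope complex_scope.
Local Open Scope sesquilinear_scope.

Set Implicit Arguments.
Unset Strict Implicit.
Unset Printing Implicit Defensive.

(** Write P for the eigenprojector P(mu), Q for its approximation Q_rb(mu), E for
    the projector onto the Taylor space, S = E - Q, and X^perp = 1 - X.

    The error bound is a deterministic statement about one Hermitian matrix B.
    Two orthogonal projectors of equal rank satisfy |Q - P| <= |Q^perp P|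
    ([proj_dist]), and Q^perp = E^perp + S splits Q^perp P into E^perp P and S P,
    whose ranges are orthogonal.  A minimizer of tr(B X) is stationary under the
    rotations of a vector of ran Q towards a vector of ran S, which gives
    S B Q = 0 ([minimizer_stationary]).  Hence S P solves the Sylvester equation
    (S P)(P B P) - (S B S)(S P) = S B E^perp P.  Near mu0 the spectrum of B on
    ran P lies entirely below the spectrum of B on ran S, with distance gamma;
    testing the equation on a top singular vector of S P yields
    |S P| <= |E B E^perp| |E^perp P| / gamma ([sylvester_bound]), and Pythagoras
    gives the factor sqrt(1 + Res^2 / gamma^2) ([rb_error_bound]).

    That the two spectra are separated near mu0 follows from continuity.  The
    value tr(A(mu0) X) exceeds its minimum tr(A(mu0) P(mu0)) by at least the
    spectral gap times |P(mu0)^perp X|^2 ([trace_gap]), so minimality of Q(mu)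
    for A(mu) forces Q(mu) --> P(mu0) ([rb_cvg]).  Bounds on the numerical range
    of a compression move continuously with the projector and the matrix
    ([numrange_le_perturb]).  Since gamma is a difference of two such bounds, the
    same lemma shows that the factor is majorized near mu0 by a function that
    tends to its value at mu0 ([rb_factor_majorant]).

    Finally E^perp annihilates the Taylor coefficients of P up to order n, so
    |E^perp P(mu)| <= P_{n+1}(0) |mu - mu0|^(n+1) + O(|mu - mu0|^(n+2))
    ([perp_analytic_le]), and the asymptotic claims result from multiplying the
    two estimates ([asymptotic_estimate]). *)

(** * The real inner product on C^N *)

(** The real part of the Hermitian inner product makes C^N a Euclidean space; as
    adjoints and norms are the same for both products, real inequalities suffice. *)
Definition rdot (R : realType) (N : nat) (u v : 'cV[R[i]]_N) : R :=
  complex.Re ((u^t* *m v) 0 0).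

Lemma adjmxM (R : realType) (m n p : nat) (X : 'M[R[i]]_(m, n)) (Y : 'M[R[i]]_(n, p)) :
  (X *m Y)^t* = Y^t* *m X^t*.
Proof. by rewrite trmx_mul map_mxM. Qed.

Lemma adjmxD (R : realType) (m n : nat) (X Y : 'M[R[i]]_(m, n)) :
  (X + Y)^t* = X^t* + Y^t*.
Proof. by rewrite linearD /= map_mxD. Qed.

Lemma adjmxB (R : realType) (m n : nat) (X Y : 'M[R[i]]_(m, n)) :
  (X - Y)^t* = X^t* - Y^t*.
Proof. by rewrite linearB /= map_mxB. Qed.

Lemma adjmx0 (R : realType) (m n : nat) : (0 : 'M[R[i]]_(m, n))^t* = 0.
Proof. by rewrite linear0 map_mx0. Qed.

Lemma rdotDr (R : realType) (N : nat) (u v w : 'cV[R[i]]_N) :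
  rdot u (v + w) = rdot u v + rdot u w.
Proof. by rewrite /rdot mulmxDr mxE raddfD. Qed.

Lemma rdotC (R : realType) (N : nat) (u v : 'cV[R[i]]_N) : rdot u v = rdot v u.
Proof.
rewrite /rdot !mxE !raddf_sum /=; apply: eq_bigr => i _; rewrite !mxE /=.
by case: (u i 0) => a b; case: (v i 0) => c e /=; rewrite mulrC [in RHS]mulrC; ring.
Qed.

Lemma rdotDl (R : realType) (N : nat) (u v w : 'cV[R[i]]_N) :
  rdot (v + w) u = rdot v u + rdot w u.
Proof. by rewrite rdotC rdotDr !(rdotC u). Qed.

Lemma rdotZr (R : realType) (N : nat) (a : R) (u v : 'cV[R[i]]_N) :
  rdot u (a%:C *: v) = a * rdot u v.
Proof.
rewrite /rdot -scalemxAr mxE; case: ((_ *m _) 0 0) => b c /=; ring.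
Qed.

Lemma rdotZl (R : realType) (N : nat) (a : R) (u v : 'cV[R[i]]_N) :
  rdot (a%:C *: u) v = a * rdot u v.
Proof. by rewrite rdotC rdotZr rdotC. Qed.

Lemma rdotNr (R : realType) (N : nat) (u v : 'cV[R[i]]_N) :
  rdot u (- v) = - rdot u v.
Proof. by rewrite -scaleN1r -(rmorphN1 (real_complex R)) rdotZr mulN1r. Qed.

Lemma rdotNl (R : realType) (N : nat) (u v : 'cV[R[i]]_N) :
  rdot (- u) v = - rdot u v.
Proof. by rewrite rdotC rdotNr rdotC. Qed.

Lemma rdot0r (R : realType) (N : nat) (u : 'cV[R[i]]_N) : rdot u 0 = 0.
Proof. by rewrite /rdot mulmx0 mxE. Qed.

Lemma rdot_adj (R : realType) (N : nat) (X : 'M[R[i]]_N) (u v : 'cV[R[i]]_N) :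
  rdot (X *m u) v = rdot u (X^t* *m v).
Proof. by rewrite /rdot adjmxM mulmxA. Qed.

Lemma hermsymmx_adj (R : realType) (N : nat) (X : 'M[R[i]]_N) :
  (X \is hermsymmx) <-> X^t* = X.
Proof.
split; first by move/is_hermitianmxP; rewrite expr0 scale1r => <-.
by move=> h; apply/is_hermitianmxP; rewrite expr0 scale1r.
Qed.

Lemma rdot_herm (R : realType) (N : nat) (X : 'M[R[i]]_N) (u v : 'cV[R[i]]_N) :
  X \is hermsymmx -> rdot (X *m u) v = rdot u (X *m v).
Proof. by move=> /hermsymmx_adj h; rewrite rdot_adj h. Qed.

Lemma rdotvv (R : realType) (N : nat) (v : 'cV[R[i]]_N) :
  rdot v v = cvnorm v ^+ 2.
Proof.
rewrite /cvnorm sqr_sqrtr; last by apply: sumr_ge0 => i _; rewrite sqr_ge0.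
rewrite /rdot !mxE raddf_sum; apply: eq_bigr => i _; rewrite !mxE /=.
case: (v i 0) => a b /=; rewrite sqr_sqrtr ?addr_ge0 ?sqr_ge0 //; ring.
Qed.

Lemma cvnorm_ge0 (R : realType) (N : nat) (v : 'cV[R[i]]_N) : 0 <= cvnorm v.
Proof. exact: sqrtr_ge0. Qed.

Lemma cvnorm_eq0 (R : realType) (N : nat) (v : 'cV[R[i]]_N) :
  cvnorm v = 0 -> v = 0.
Proof.
move=> /eqP; rewrite sqrtr_eq0 => h.
have /psumr_eq0P h0 : \sum_i normc (v i 0) ^+ 2 = 0.
  by apply/eqP; rewrite eq_le h sumr_ge0 // => i _; rewrite sqr_ge0.
apply/matrixP => i j; rewrite ord1 mxE; apply: eq0_normc.
by apply/eqP; rewrite -sqrf_eq0 h0 // => k _; rewrite sqr_ge0.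
Qed.

Lemma cvnorm_gt0 (R : realType) (N : nat) (v : 'cV[R[i]]_N) :
  v != 0 -> 0 < cvnorm v.
Proof.
rewrite lt_def cvnorm_ge0 andbT; apply: contra => /eqP h.
by rewrite (cvnorm_eq0 h).
Qed.

Lemma cvnorm0 (R : realType) (N : nat) : cvnorm (0 : 'cV[R[i]]_N) = 0.
Proof. by apply/eqP; rewrite -sqrf_eq0 -rdotvv rdot0r. Qed.

(** Cauchy-Schwarz, from the nonnegative square of |v| u - |u| v. *)
Lemma rdot_le (R : realType) (N : nat) (u v : 'cV[R[i]]_N) :
  rdot u v <= cvnorm u * cvnorm v.
Proof.
have [->|/cvnorm_gt0 u0] := eqVneq u 0; first by rewrite rdotC rdot0r cvnorm0 mul0r.
have [->|/cvnorm_gt0 v0] := eqVneq v 0; first by rewrite rdot0r cvnorm0 mulr0.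
set a := cvnorm u in u0 *; set b := cvnorm v in v0 *.
have : 0 <= rdot (b%:C *: u - a%:C *: v) (b%:C *: u - a%:C *: v).
  by rewrite rdotvv sqr_ge0.
rewrite !(rdotDl, rdotDr, rdotNl, rdotNr, rdotZl, rdotZr) (rdotC v u) !rdotvv -/a -/b.
rewrite [leRHS](_ : _ = 2 * (a * b) * (a * b - rdot u v)); last by ring.
by rewrite pmulr_rge0 ?subr_ge0 // !mulr_gt0.
Qed.

Lemma cvnormD (R : realType) (N : nat) (u v : 'cV[R[i]]_N) :
  cvnorm (u + v) <= cvnorm u + cvnorm v.
Proof.
rewrite -(@ler_pXn2r _ 2) ?nnegrE ?addr_ge0 ?cvnorm_ge0 // -rdotvv.
rewrite !(rdotDl, rdotDr) !rdotvv (rdotC v u).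
have := rdot_le u v; nra.
Qed.

Lemma cvnormZ (R : realType) (N : nat) (a : R) (u : 'cV[R[i]]_N) :
  cvnorm (a%:C *: u) = `|a| * cvnorm u.
Proof.
apply/eqP; rewrite -(@eqrXn2 _ 2) ?mulr_ge0 ?cvnorm_ge0 // -rdotvv.
by rewrite rdotZl rdotZr rdotvv exprMn real_normK ?num_real // mulrA.
Qed.

Lemma cvnormN (R : realType) (N : nat) (u : 'cV[R[i]]_N) : cvnorm (- u) = cvnorm u.
Proof. by rewrite -scaleN1r -(rmorphN1 (real_complex R)) cvnormZ normrN1 mul1r. Qed.

(** * Rayleigh quotients and the spectral norm *)

(** The spectral theorem diagonalizes T in a unitary basis; a basis vector of
    smallest eigenvalue attains the minimum of the Rayleigh quotient. *)
Lemma rayleigh_min (R : realType) (N : nat) (T : 'M[R[i]]_N) :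
  (0 < N)%N -> T \is hermsymmx ->
  exists (m : R) (v : 'cV[R[i]]_N), [/\ v != 0, T *m v = m%:C *: v &
    forall y, m * cvnorm y ^+ 2 <= rdot y (T *m y)].
Proof.
move=> N0 hT; have /orthomx_spectralP eT := hermitian_normalmx hT.
set U := spectralmx T in eT; set D := spectral_diag T in eT.
have Uu : U \is unitarymx by apply: spectral_unitarymx.
have D_real i : D 0 i = (complex.Re (D 0 i))%:C.
  have /mxOverP /(_ 0 i) h := hermitian_spectral_diag_real hT.
  by rewrite RRe_real.
rewrite (invmx_unitary Uu) in eT.
have UU : U *m U^t* = 1%:M by apply/unitarymxP.
have UU' : U^t* *m U = 1%:M by apply: mulmx1C.
have [k _ kmin] := @arg_minP _ _ 'I_N (Ordinal N0) predT (fun i => complex.Re (D 0 i)) isT.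
exists (complex.Re (D 0 k)), (U^t* *m delta_mx k 0); split.
- apply/eqP => /(congr1 (mulmx U)); rewrite mulmxA UU mul1mx mulmx0.
  by move/matrixP/(_ k 0); rewrite !mxE !eqxx => /eqP; rewrite oner_eq0.
- rewrite eT -!mulmxA (mulmxA U) UU mul1mx.
  rewrite mul_diag_mx -D_real scalemxAr; congr (_ *m _).
  apply/matrixP => i j; rewrite !mxE; case: (i =P k) => [->|] //=.
  by rewrite !mulr0.
move=> y; rewrite eT -!mulmxA -rdot_adj.
have -> : cvnorm y ^+ 2 = cvnorm (U *m y) ^+ 2.
  by rewrite -!rdotvv rdot_adj mulmxA UU' mul1mx.
rewrite -rdotvv; move: (U *m y) => z; rewrite /rdot mul_diag_mx !mxE !raddf_sum mulr_sumr.
apply: ler_sum => i _; rewrite !mxE /= [D 0 i]D_real.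
have := kmin i isT; set a := complex.Re _; set b := complex.Re _.
case: (z i 0) => x w /=; have := sqr_ge0 x; have := sqr_ge0 w; nra.
Qed.

Local Opaque cvnorm.

Lemma adjmxK (R : realType) (m n : nat) (X : 'M[R[i]]_(m, n)) : (X^t*)^t* = X.
Proof. exact: trmxCK. Qed.

Lemma herm_gram (R : realType) (N : nat) (X : 'M[R[i]]_N) :
  X^t* *m X \is hermsymmx.
Proof. by apply/hermsymmx_adj; rewrite adjmxM adjmxK. Qed.

Lemma hermN (R : realType) (N : nat) (X : 'M[R[i]]_N) :
  X \is hermsymmx -> - X \is hermsymmx.
Proof. by move=> /hermsymmx_adj h; apply/hermsymmx_adj; rewrite linearN /= map_mxN h. Qed.

(** A bottom eigenvector of - X^* X is a vector on which X attains its norm. *)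
Lemma top_singular_vector (R : realType) (N : nat) (X : 'M[R[i]]_N) :
  (0 < N)%N -> exists (s : R) (v : 'cV[R[i]]_N),
    [/\ 0 <= s, v != 0, X^t* *m (X *m v) = (s ^+ 2)%:C *: v &
        forall y, cvnorm (X *m y) <= s * cvnorm y].
Proof.
move=> N0; have [m [v [v0 ev mle]]] := rayleigh_min N0 (hermN (herm_gram X)).
have mX y : cvnorm (X *m y) ^+ 2 <= - m * cvnorm y ^+ 2.
  have := mle y; rewrite mulNmx rdotNr -mulmxA -rdot_adj rdotvv; lra.
have m0 : 0 <= - m.
  have := le_trans (sqr_ge0 _) (mX v).
  by rewrite pmulr_lge0 // exprn_gt0 // cvnorm_gt0.
exists (Num.sqrt (- m)), v; split=> //.
  by rewrite sqr_sqrtr // mulmxA rmorphN scaleNr -ev mulNmx opprK.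
move=> y; rewrite -(@ler_pXn2r _ 2) ?nnegrE ?mulr_ge0 ?cvnorm_ge0 ?sqrtr_ge0 //.
by rewrite exprMn (sqr_sqrtr m0).
Qed.

Lemma cvnorm_mul_bounded (R : realType) (N : nat) (X : 'M[R[i]]_N) :
  exists2 c : R, 0 <= c & forall y, cvnorm (X *m y) <= c * cvnorm y.
Proof.
case: (posnP N) => [N0|/(top_singular_vector X) [s [v [s0 _ _ h]]]]; last by exists s.
subst N; exists 0 => // y.
by rewrite [X *m y](_ : _ = 0) ?cvnorm0 ?mul0r //; apply/matrixP => -[].
Qed.

Lemma has_sup_spnorm (R : realType) (N : nat) (X : 'M[R[i]]_N) :
  has_sup [set cvnorm (X *m y) | y in [set y | cvnorm y <= 1]].
Proof.
have [c c0 h] := cvnorm_mul_bounded X; split.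
  by exists (cvnorm (X *m 0)), 0 => //=; rewrite cvnorm0.
exists c => _ [y /= y1 <-]; apply: le_trans (h y) _.
by rewrite -[leRHS]mulr1 ler_wpM2l.
Qed.

Lemma le_spnorm (R : realType) (N : nat) (X : 'M[R[i]]_N) (y : 'cV_N) :
  cvnorm (X *m y) <= spnorm X * cvnorm y.
Proof.
have [->|y0] := eqVneq y 0; first by rewrite mulmx0 cvnorm0 mulr0.
rewrite -ler_pdivrMr ?cvnorm_gt0 //.
apply: sup_upper_bound; first exact: has_sup_spnorm.
exists ((cvnorm y)^-1%:C *: y) => /=.
  by rewrite cvnormZ ger0_norm ?invr_ge0 ?cvnorm_ge0 // mulVf // gt_eqF ?cvnorm_gt0.
by rewrite -scalemxAr cvnormZ ger0_norm ?invr_ge0 ?cvnorm_ge0 // mulrC.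
Qed.

Lemma spnorm_le (R : realType) (N : nat) (X : 'M[R[i]]_N) (c : R) :
  0 <= c -> (forall y, cvnorm (X *m y) <= c * cvnorm y) -> spnorm X <= c.
Proof.
move=> c0 h; apply: ge_sup; first by case: (has_sup_spnorm X).
move=> _ [y /= y1 <-]; apply: le_trans (h y) _.
by rewrite -[leRHS]mulr1 ler_wpM2l.
Qed.

Lemma spnorm_ge0 (R : realType) (N : nat) (X : 'M[R[i]]_N) : 0 <= spnorm X.
Proof.
apply: sup_upper_bound; first exact: has_sup_spnorm.
by exists 0; rewrite /= ?mulmx0 cvnorm0.
Qed.

Local Opaque spnorm.

Lemma spnormD (R : realType) (N : nat) (X Y : 'M[R[i]]_N) :
  spnorm (X + Y) <= spnorm X + spnorm Y.
Proof.
apply: spnorm_le => [|y]; first by rewrite addr_ge0 ?spnorm_ge0.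
by rewrite mulmxDl mulrDl (le_trans (cvnormD _ _)) // lerD ?le_spnorm.
Qed.

Lemma spnormM (R : realType) (N : nat) (X Y : 'M[R[i]]_N) :
  spnorm (X *m Y) <= spnorm X * spnorm Y.
Proof.
apply: spnorm_le => [|y]; first by rewrite mulr_ge0 ?spnorm_ge0.
rewrite -mulmxA -mulrA (le_trans (le_spnorm _ _)) //.
by rewrite ler_wpM2l ?spnorm_ge0 ?le_spnorm.
Qed.

Lemma spnormZ_le (R : realType) (N : nat) (a : R) (X : 'M[R[i]]_N) :
  spnorm (a%:C *: X) <= `|a| * spnorm X.
Proof.
apply: spnorm_le => [|y]; first by rewrite mulr_ge0 ?spnorm_ge0.
by rewrite -scalemxAl cvnormZ -mulrA ler_wpM2l ?le_spnorm.
Qed.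

Lemma spnormN (R : realType) (N : nat) (X : 'M[R[i]]_N) : spnorm (- X) = spnorm X.
Proof.
have h (Y : 'M[R[i]]_N) : spnorm (- Y) <= spnorm Y.
  by apply: spnorm_le => [|y]; rewrite ?spnorm_ge0 // mulNmx cvnormN le_spnorm.
by apply/le_anti/andP; split; [exact: h | have := h (- X); rewrite opprK].
Qed.

Lemma spnorm0 (R : realType) (N : nat) : spnorm (0 : 'M[R[i]]_N) = 0.
Proof.
apply/eqP; rewrite eq_le spnorm_ge0 andbT.
by apply: spnorm_le => // y; rewrite mul0mx cvnorm0 mul0r.
Qed.

Lemma spnorm_eq0 (R : realType) (N : nat) (X : 'M[R[i]]_N) : spnorm X <= 0 -> X = 0.
Proof.
move=> X0; apply/matrixP => k l; rewrite mxE.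
have /cvnorm_eq0 : cvnorm (X *m delta_mx l 0) = 0.
  apply/eqP; rewrite eq_le cvnorm_ge0 andbT (le_trans (le_spnorm _ _)) //.
  by rewrite mulr_le0_ge0 ?cvnorm_ge0.
by rewrite -colE => /matrixP/(_ k 0); rewrite !mxE.
Qed.

Lemma spnorm_sum (R : realType) (N : nat) (I : Type) (r : seq I) (F : I -> 'M[R[i]]_N) :
  spnorm (\sum_(k <- r) F k) <= \sum_(k <- r) spnorm (F k).
Proof.
elim/big_ind2: _ => [|X x Y y hx hy|//]; first by rewrite spnorm0.
by rewrite (le_trans (spnormD _ _)) ?lerD.
Qed.

Lemma spnorm_adj (R : realType) (N : nat) (X : 'M[R[i]]_N) : spnorm (X^t*) = spnorm X.
Proof.
have h (Y : 'M[R[i]]_N) : spnorm (Y^t*) <= spnorm Y.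
  apply: spnorm_le => [|y]; first exact: spnorm_ge0.
  have [->|y0] := eqVneq (Y^t* *m y) 0; first by rewrite cvnorm0 mulr_ge0 ?spnorm_ge0 ?cvnorm_ge0.
  rewrite -(ler_pM2r (cvnorm_gt0 y0)) -expr2 -rdotvv rdot_adj adjmxK.
  apply: le_trans (rdot_le _ _) _.
  by rewrite [leLHS]mulrC mulrAC ler_wpM2r ?cvnorm_ge0 ?le_spnorm.
by apply/le_anti/andP; split; [exact: h | have := h (X^t*); rewrite adjmxK].
Qed.

(** * Orthogonal projectors *)

Lemma orthoproj_rdot (R : realType) (N : nat) (E : 'M[R[i]]_N) (y : 'cV_N) :
  orthoproj E -> rdot y (E *m y) = cvnorm (E *m y) ^+ 2.
Proof. by move=> [EE Eh]; rewrite -rdotvv (rdot_herm _ _ Eh) mulmxA EE. Qed.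

Lemma orthoproj_perp (R : realType) (N : nat) (E : 'M[R[i]]_N) :
  orthoproj E -> orthoproj (perpmx E).
Proof.
move=> [EE /hermsymmx_adj Eh]; split.
  by rewrite /perpmx mulmxBl mul1mx mulmxBr EE mulmx1 subrr subr0.
apply/hermsymmx_adj; rewrite /perpmx linearB /= map_mxB Eh; congr (_ - _).
by rewrite trmx1 map_scalar_mx rmorph1.
Qed.

Lemma perpmx_mul0 (R : realType) (N : nat) (E : 'M[R[i]]_N) :
  orthoproj E -> perpmx E *m E = 0 /\ E *m perpmx E = 0.
Proof.
by move=> [EE _]; rewrite /perpmx mulmxBl mulmxBr mul1mx mulmx1 EE subrr.
Qed.

Lemma cvnorm_pythag (R : realType) (N : nat) (E : 'M[R[i]]_N) (y : 'cV_N) :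
  orthoproj E ->
  cvnorm y ^+ 2 = cvnorm (E *m y) ^+ 2 + cvnorm (perpmx E *m y) ^+ 2.
Proof.
move=> hE; rewrite -orthoproj_rdot // -orthoproj_rdot; last exact: orthoproj_perp.
by rewrite -rdotDr -mulmxDl /perpmx addrC subrK mul1mx rdotvv.
Qed.

Lemma cvnorm_orthoproj (R : realType) (N : nat) (E : 'M[R[i]]_N) (y : 'cV_N) :
  orthoproj E -> cvnorm (E *m y) <= cvnorm y.
Proof.
move=> hE; rewrite -(@ler_pXn2r _ 2) ?nnegrE ?cvnorm_ge0 //.
by rewrite (cvnorm_pythag y hE) lerDl sqr_ge0.
Qed.

Lemma spnorm_orthoproj (R : realType) (N : nat) (E : 'M[R[i]]_N) :
  orthoproj E -> spnorm E <= 1.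
Proof.
by move=> hE; apply: spnorm_le => // y; rewrite mul1r cvnorm_orthoproj.
Qed.

Lemma orthoproj_small (R : realType) (N : nat) (E : 'M[R[i]]_N) :
  orthoproj E -> spnorm E < 1 -> E = 0.
Proof.
move=> [EE _] E1; apply: spnorm_eq0.
have := spnormM E E; rewrite EE; have := spnorm_ge0 E; nra.
Qed.

Lemma orthoproj_sub (R : realType) (N : nat) (E Q : 'M[R[i]]_N) :
  orthoproj E -> orthoproj Q -> E *m Q = Q -> orthoproj (E - Q) /\ Q *m E = Q.
Proof.
move=> [EE /hermsymmx_adj Eh] [QQ /hermsymmx_adj Qh] EQ.
have QE : Q *m E = Q by rewrite -[LHS]adjmxK adjmxM Eh Qh EQ Qh.
split=> //; split; last by apply/hermsymmx_adj; rewrite adjmxB Eh Qh.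
by rewrite mulmxBl !mulmxBr EE EQ QE QQ subrr subr0.
Qed.

(** The minimum of the Rayleigh quotient over ran E is attained at an eigenvector
    of the compression of B.  It is found as an eigenvector of E B E + c E^perp,
    where c is so large that the smallest eigenvalue is not c. *)
Lemma rayleigh_min_on (R : realType) (N : nat) (E B : 'M[R[i]]_N) :
  orthoproj E -> E != 0 -> B \is hermsymmx ->
  exists (m : R) (v : 'cV[R[i]]_N),
    [/\ v != 0, E *m v = v, E *m (B *m v) = m%:C *: v &
      forall y, E *m y = y -> m * cvnorm y ^+ 2 <= rdot y (B *m y)].
Proof.
move=> hE E0 hB; have [EE Eh] := hE.
have [u Eu u0] : exists2 u : 'cV_N, E *m u = u & u != 0.
  have /existsP[j Ej] : [exists j, col j E != 0].
    apply: contraNT E0 => /existsPn h; apply/eqP/matrixP => k l.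
    by have /eqP/matrixP/(_ k 0) := negPn (h l); rewrite !mxE.
  by exists (col j E) => //; rewrite colE mulmxA EE.
have N0 : (0 < N)%N.
  by case: (N) u u0 {Eu} => // u /eqP[]; apply/matrixP => -[].
(* One more than the Rayleigh quotient of the vector u of ran E. *)
pose c := rdot u (B *m u) / cvnorm u ^+ 2 + 1.
pose T := E *m B *m E + c%:C *: perpmx E.
have hT : T \is hermsymmx.
  move/hermsymmx_adj in hB; move/hermsymmx_adj in Eh;
  have [_ /hermsymmx_adj Fh] := orthoproj_perp hE.
  apply/hermsymmx_adj; rewrite /T linearD linearZ /= map_mxD map_mxZ !adjmxM Fh hB Eh mulmxA.
  by congr (_ + _ *: _); rewrite -[RHS]conjc_real.
have TE (y : 'cV_N) : E *m y = y -> T *m y = E *m (B *m y).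
  move=> Ey; rewrite mulmxDl -scalemxAl -{2}Ey [perpmx E *m _]mulmxA.
  by rewrite (perpmx_mul0 hE).1 mul0mx scaler0 addr0 -!mulmxA Ey.
have rT y : E *m y = y -> rdot y (T *m y) = rdot y (B *m y).
  by move=> Ey; rewrite (TE y Ey) -(rdot_herm _ _ Eh) Ey.
have ET : E *m T = T *m E.
  rewrite /T mulmxDr mulmxDl -scalemxAr -scalemxAl (perpmx_mul0 hE).1 (perpmx_mul0 hE).2.
  by congr (_ + _); rewrite !mulmxA EE -[RHS]mulmxA EE.
have [m [w [w0 Tw mle]]] := rayleigh_min N0 hT.
have Ew0 : E *m w != 0.
  apply/eqP => Ew; have := mle u; rewrite rT //.
  have -> : m = c.
    have : T *m w = c%:C *: w.
      by rewrite /T mulmxDl -!mulmxA Ew !mulmx0 add0r -scalemxAl /perpmx mulmxBl Ew mul1mx subr0.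
    rewrite Tw => /eqP; rewrite -subr_eq0 -scalerBl scaler_eq0 (negPf w0) orbF.
    by rewrite -rmorphB /= -[0]/(0%:C) => /eqP[] /eqP; rewrite subr_eq0 => /eqP.
  rewrite /c mulrDl mul1r mulfVK; last by rewrite gt_eqF // exprn_gt0 // cvnorm_gt0.
  by rewrite gerDl leNgt exprn_gt0 // cvnorm_gt0.
have EEw : E *m (E *m w) = E *m w by rewrite mulmxA EE.
exists m, (E *m w); split=> //.
  by rewrite -(TE (E *m w) EEw) mulmxA -ET -mulmxA Tw scalemxAr.
by move=> y Ey; rewrite -rT.
Qed.

(** In a rank factorization E = C R the identity E E = E means R C = 1. *)
Lemma orthoproj_rank_tr (R : realType) (N : nat) (E : 'M[R[i]]_N) :
  orthoproj E -> \tr E = (\rank E)%:R.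
Proof.
move=> [EE _]; have RC : row_base E *m col_base E = 1%:M.
  apply: (@row_free_inj _ _ _ _ (row_base E)); first exact: row_base_free.
  have /row_fullP[L LC] : row_full (col_base E) by apply: col_base_full.
  have : col_base E *m (row_base E *m col_base E *m row_base E) = E.
    by rewrite 2!(mulmxA (col_base E)) mulmx_base -(mulmxA E) mulmx_base EE.
  rewrite -[in RHS](mulmx_base E) => /(congr1 (mulmx L)).
  by rewrite 2!(mulmxA L) LC !mul1mx.
by rewrite -[in LHS](mulmx_base E) mxtrace_mulC RC mxtrace1.
Qed.

(** Subspaces are row spaces of transposes, so X^T <= V says that the columns of X
    lie in ran E. *)
Lemma proj_absorb (R : realType) (N : nat) (E V X : 'M[R[i]]_N) :
  orthoproj_onto E V -> (X^T <= V)%MS -> E *m X = X.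
Proof.
move=> [[EE _] EV]; rewrite -EV => /submxP[L].
by move=> /(congr1 trmx); rewrite trmxK trmx_mul trmxK => ->; rewrite mulmxA EE.
Qed.

(** Equality of the two norms, stated as one inequality, is where the ranks enter.
    If s = |Q^perp P| < 1 then Q is injective on ran P, hence maps ran P onto
    ran Q; and if z = Q y with y in ran P, then |z|^2 = <P z, y> together with
    |z|^2 >= (1 - s^2) |y|^2 gives |P z|^2 >= (1 - s^2) |z|^2. *)
Lemma proj_swap (R : realType) (N : nat) (P Q : 'M[R[i]]_N) :
  orthoproj P -> orthoproj Q -> \rank P = \rank Q ->
  spnorm (perpmx P *m Q) <= spnorm (perpmx Q *m P).
Proof.
move=> hP hQ rk; set s := spnorm (perpmx Q *m P).
have s0 : 0 <= s := spnorm_ge0 _.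
have [s1|s1] := leP 1 s.
  apply: le_trans s1; apply: le_trans (spnormM _ _) _.
  apply: mulr_ile1; [exact: spnorm_ge0 | exact: spnorm_ge0 | |].
    exact/spnorm_orthoproj/orthoproj_perp.
  exact: spnorm_orthoproj.
have [PP Ph] := hP; have [QQ Qh] := hQ.
have Qlow y : P *m y = y -> (1 - s ^+ 2) * cvnorm y ^+ 2 <= cvnorm (Q *m y) ^+ 2.
  move=> Py; rewrite mulrBl mul1r lerBlDr [leLHS](cvnorm_pythag y hQ) lerD2l -exprMn.
  rewrite lerXn2r ?nnegrE ?mulr_ge0 ?cvnorm_ge0 //.
  by rewrite -{1}Py mulmxA le_spnorm.
have s2 : 0 < 1 - s ^+ 2 by nra.
have QPfull : (Q^T <= P^T *m Q^T)%MS.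
  have := mxrank_mul_ker P^T Q^T.
  rewrite (_ : (P^T :&: kermx Q^T)%MS = 0).
    rewrite mxrank0 addn0 mxrank_tr rk -[in RHS]mxrank_tr => h.
    by rewrite -(geq_leqif (mxrank_leqif_sup (submxMl _ _))) h.
  apply/eqP; rewrite -submx0; apply/rV_subP => w; rewrite sub_capmx submx0.
  move=> /andP[/submxP[L wL] /sub_kermxP wQ]; apply/eqP/trmx_inj; rewrite linear0.
  have Pw : P *m w^T = w^T by rewrite wL trmx_mul trmxK mulmxA PP.
  have Qw : Q *m w^T = 0 by rewrite -[Q]trmxK -trmx_mul wQ linear0.
  apply: cvnorm_eq0; have := Qlow _ Pw; rewrite Qw cvnorm0 expr0n /=.
  by rewrite pmulr_rle0 // => h; apply/eqP; rewrite -sqrf_eq0 eq_le h sqr_ge0.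
apply: spnorm_le => // x; rewrite -mulmxA; set z := Q *m x.
have Qz : Q *m z = z by rewrite mulmxA QQ.
have [y Py Qy] : exists2 y, P *m y = y & Q *m y = z.
  have : (z^T <= Q^T)%MS by rewrite /z trmx_mul submxMl.
  move=> /submx_trans/(_ QPfull)/submxP[L zL].
  exists (P *m L^T); first by rewrite mulmxA PP.
  by apply: trmx_inj; rewrite zL !trmx_mul trmxK mulmxA.
apply: (@le_trans _ _ (s * cvnorm z)); last by rewrite ler_wpM2l // cvnorm_orthoproj.
rewrite -(@ler_pXn2r _ 2) ?nnegrE ?mulr_ge0 ?cvnorm_ge0 // exprMn.
have h1 : cvnorm z ^+ 2 <= cvnorm (P *m z) * cvnorm y.
  by rewrite -rdotvv -{2}Qy -rdot_herm // Qz -{1}Py -rdot_herm // rdot_le.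
have h2 := Qlow _ Py; rewrite Qy in h2.
have h3 := cvnorm_pythag z hP.
have [->|z0] := eqVneq z 0; first by rewrite mulmx0 cvnorm0 expr0n mulr0.
have {z0} z0 := cvnorm_gt0 z0.
suff : (1 - s ^+ 2) * cvnorm z ^+ 2 <= cvnorm (P *m z) ^+ 2 by lra.
rewrite -(ler_pM2r (exprn_gt0 2 z0)).
apply: (@le_trans _ _ ((1 - s ^+ 2) * (cvnorm (P *m z) * cvnorm y) ^+ 2)).
  rewrite -mulrA -expr2 ler_wpM2l ?(ltW s2) // lerXn2r ?nnegrE ?sqr_ge0 //.
  by rewrite mulr_ge0 ?cvnorm_ge0.
by rewrite exprMn mulrCA ler_wpM2l ?sqr_ge0.
Qed.

(** Q - P = Q P^perp - Q^perp P, where the two terms have orthogonal ranges and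
    orthogonal supports, so its norm is the larger of the norms of the terms. *)
Lemma proj_dist (R : realType) (N : nat) (P Q : 'M[R[i]]_N) :
  orthoproj P -> orthoproj Q -> \rank P = \rank Q ->
  spnorm (Q - P) <= spnorm (perpmx Q *m P).
Proof.
move=> hP hQ rk; have sw := proj_swap hP hQ rk.
set s := spnorm (perpmx Q *m P) in sw *.
have [PP Ph] := hP; have [QQ Qh] := hQ.
have hP' := orthoproj_perp hP; have hQ' := orthoproj_perp hQ.
have {}sw : spnorm (Q *m perpmx P) <= s.
  rewrite -spnorm_adj adjmxM; have /hermsymmx_adj -> := hP'.2; by have /hermsymmx_adj -> := Qh.
apply: spnorm_le => [|y]; first exact: spnorm_ge0.
have e1 : Q *m ((Q - P) *m y) = Q *m perpmx P *m (perpmx P *m y).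
  rewrite -mulmxA [perpmx P *m (_ *m _)]mulmxA hP'.1 [perpmx P]/perpmx.
  by rewrite !mulmxBl !mulmxBr mul1mx [Q *m (Q *m y)]mulmxA QQ.
have e2 : perpmx Q *m ((Q - P) *m y) = - (perpmx Q *m P *m (P *m y)).
  rewrite -mulmxA (mulmxA P P) PP (mulmxBl Q P) mulmxBr [perpmx Q *m (Q *m _)]mulmxA.
  by rewrite (perpmx_mul0 hQ).1 mul0mx sub0r.
rewrite -(@ler_pXn2r _ 2) ?nnegrE ?mulr_ge0 ?cvnorm_ge0 ?spnorm_ge0 //.
rewrite (cvnorm_pythag _ hQ) e1 e2 cvnormN exprMn (cvnorm_pythag y hP) mulrDr addrC -!exprMn.
rewrite lerD // lerXn2r ?nnegrE ?mulr_ge0 ?cvnorm_ge0 ?spnorm_ge0 //; first exact: le_spnorm.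
by apply: le_trans (le_spnorm _ _) _; apply: ler_wpM2r (cvnorm_ge0 _) _ _ sw.
Qed.

(** * Real traces and rank-one projectors *)

Definition rtr (R : realType) (N : nat) (X : 'M[R[i]]_N) : R := complex.Re (\tr X).

Lemma rtrD (R : realType) (N : nat) (X Y : 'M[R[i]]_N) : rtr (X + Y) = rtr X + rtr Y.
Proof. by rewrite /rtr !raddfD. Qed.

Lemma rtrN (R : realType) (N : nat) (X : 'M[R[i]]_N) : rtr (- X) = - rtr X.
Proof. by rewrite /rtr !raddfN. Qed.

Lemma rtrZ (R : realType) (N : nat) (a : R) (X : 'M[R[i]]_N) : rtr (a%:C *: X) = a * rtr X.
Proof. rewrite /rtr mxtraceZ; case: (\tr X) => x y /=; ring. Qed.

Lemma rtrC (R : realType) (N : nat) (X Y : 'M[R[i]]_N) : rtr (X *m Y) = rtr (Y *m X).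
Proof. by rewrite /rtr mxtrace_mulC. Qed.

Lemma rtrE (R : realType) (N : nat) (X : 'M[R[i]]_N) :
  rtr X = \sum_j rdot (delta_mx j 0) (X *m delta_mx j 0).
Proof.
rewrite /rtr /mxtrace raddf_sum; apply: eq_bigr => j _; rewrite /rdot -colE mxE.
rewrite (bigD1 j) //= !mxE !eqxx /= rmorph1 mul1r big1 ?addr0 // => k kj.
by rewrite !mxE (negPf kj) /= rmorph0 mul0r.
Qed.

Lemma rtr_ge0 (R : realType) (N : nat) (X : 'M[R[i]]_N) :
  (forall y, 0 <= rdot y (X *m y)) -> 0 <= rtr X.
Proof. by move=> h; rewrite rtrE sumr_ge0. Qed.

(** tr(X E) = tr(E X E), and E X E is positive semidefinite when X is. *)
Lemma rtr_conj_ge0 (R : realType) (N : nat) (E X : 'M[R[i]]_N) :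
  orthoproj E -> (forall y, 0 <= rdot y (X *m y)) -> 0 <= rtr (X *m E).
Proof.
move=> [EE Eh] h; rewrite -EE mulmxA rtrC mulmxA; apply: rtr_ge0 => y.
by rewrite -mulmxA -mulmxA -rdot_herm.
Qed.

Lemma cvnorm_delta (R : realType) (N : nat) (j : 'I_N) :
  cvnorm (delta_mx j 0 : 'cV[R[i]]_N) = 1.
Proof.
apply/eqP; rewrite -(@eqrXn2 _ 2) ?cvnorm_ge0 // -rdotvv expr1n.
rewrite /rdot mxE (bigD1 j) //= !mxE !eqxx /= rmorph1 mul1r big1 ?addr0 // => k kj.
by rewrite !mxE (negPf kj) /= mulr0.
Qed.

Lemma rtr_le (R : realType) (N : nat) (X : 'M[R[i]]_N) : rtr X <= N%:R * spnorm X.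
Proof.
rewrite rtrE (le_trans (ler_sum _ (fun j _ => rdot_le _ _))) //.
rewrite mulr_natl -[X in _ *+ X]card_ord -sumr_const ler_sum // => j _.
by rewrite cvnorm_delta mul1r (le_trans (le_spnorm _ _)) // cvnorm_delta mulr1.
Qed.

(** The orthogonal projector onto the line spanned by y, for nonzero y. *)
Definition outer (R : realType) (N : nat) (y : 'cV[R[i]]_N) : 'M[R[i]]_N :=
  (cvnorm y ^+ 2)^-1%:C *: (y *m y^t*).

Lemma adj_self (R : realType) (N : nat) (y : 'cV[R[i]]_N) :
  y^t* *m y = (cvnorm y ^+ 2)%:C%:M.
Proof.
apply/matrixP => k l; rewrite !ord1 !mxE eqxx mulr1n -rdotvv /rdot mxE.
rewrite raddf_sum [RHS]rmorph_sum; apply: eq_bigr => j _; rewrite !mxE /=.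
by case: (y j 0) => a b; apply/eqP; rewrite eq_complex /=; apply/andP; split=> //; apply/eqP; ring.
Qed.

Lemma outer_self (R : realType) (N : nat) (y : 'cV[R[i]]_N) : y != 0 -> outer y *m y = y.
Proof.
move=> y0; rewrite -scalemxAl -mulmxA adj_self mul_mx_scalar scalerA -rmorphM /=.
by rewrite mulVf ?scale1r // gt_eqF // exprn_gt0 // cvnorm_gt0.
Qed.

Lemma outer_adj (R : realType) (N : nat) (y : 'cV[R[i]]_N) : (outer y)^t* = outer y.
Proof.
rewrite /outer linearZ /= map_mxZ adjmxM adjmxK.
by congr (_ *: _); exact: conjc_real.
Qed.

Lemma outer_orthoproj (R : realType) (N : nat) (y : 'cV[R[i]]_N) :
  y != 0 -> orthoproj (outer y).
Proof.
move=> y0; split; first by rewrite {2}/outer -scalemxAr mulmxA outer_self.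
by apply/hermsymmx_adj; exact: outer_adj.
Qed.

Lemma mul_outer (R : realType) (N : nat) (X : 'M[R[i]]_N) (y : 'cV[R[i]]_N) :
  X *m y = y -> X *m outer y = outer y.
Proof. by move=> Xy; rewrite /outer -scalemxAr mulmxA Xy. Qed.

Lemma mul_outer0 (R : realType) (N : nat) (X : 'M[R[i]]_N) (y : 'cV[R[i]]_N) :
  X *m y = 0 -> X *m outer y = 0.
Proof. by move=> Xy; rewrite /outer -scalemxAr mulmxA Xy mul0mx scaler0. Qed.

Lemma rtr_outer (R : realType) (N : nat) (X : 'M[R[i]]_N) (y : 'cV[R[i]]_N) :
  rtr (X *m outer y) = rdot y (X *m y) / cvnorm y ^+ 2.
Proof.
rewrite /outer -scalemxAr rtrZ mulrC mulmxA; congr (_ / _).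
by rewrite /rtr mxtrace_mulC /rdot /mxtrace big_ord1.
Qed.

Lemma tr_outer (R : realType) (N : nat) (y : 'cV[R[i]]_N) : y != 0 -> \tr (outer y) = 1.
Proof.
move=> y0; rewrite /outer mxtraceZ mxtrace_mulC adj_self mxtrace_scalar mulr1n -rmorphM /=.
by rewrite mulVf // gt_eqF // exprn_gt0 // cvnorm_gt0.
Qed.

(** Projecting Y^* Y onto its top singular vector leaves the largest eigenvalue
    |Y|^2, and the complementary part of the trace is nonnegative. *)
Lemma spnorm_le_frob (R : realType) (N : nat) (Y : 'M[R[i]]_N) :
  spnorm Y ^+ 2 <= rtr (Y^t* *m Y).
Proof.
have gram_ge0 y : 0 <= rdot y (Y^t* *m Y *m y).
  by rewrite -mulmxA -rdot_adj rdotvv sqr_ge0.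
case: (posnP N) => [N0|/(top_singular_vector Y) [s [v [s0 v0 sv sle]]]].
  have -> : spnorm Y = 0.
    apply/eqP; rewrite eq_le spnorm_ge0 andbT spnorm_le // => y.
    by subst N; rewrite [Y *m y](_ : _ = 0) ?cvnorm0 ?mul0r //; apply/matrixP => -[].
  by rewrite expr0n rtr_ge0.
apply: (@le_trans _ _ (s ^+ 2)).
  by rewrite lerXn2r ?nnegrE ?spnorm_ge0 // spnorm_le.
have -> : s ^+ 2 = rtr (Y^t* *m Y *m outer v).
  rewrite rtr_outer -mulmxA sv rdotZr rdotvv mulfK //.
  by rewrite gt_eqF // exprn_gt0 // cvnorm_gt0.
rewrite -subr_ge0 -rtrN -rtrD -{1}[_ *m Y]mulmx1 -mulmxBr.
apply: rtr_conj_ge0 => //; apply: orthoproj_perp; exact: outer_orthoproj.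
Qed.

Local Opaque outer.

(** * Trace minimization *)

(** The spectrum of a compression is controlled through its numerical range,
    which behaves better than single eigenvalues under perturbation. *)
Definition numrange_le (R : realType) (N : nat) (E B : 'M[R[i]]_N) (a : R) : Prop :=
  forall y : 'cV_N, E *m y = y -> rdot y (B *m y) <= a * cvnorm y ^+ 2.

Definition numrange_ge (R : realType) (N : nat) (E B : 'M[R[i]]_N) (b : R) : Prop :=
  forall y : 'cV_N, E *m y = y -> b * cvnorm y ^+ 2 <= rdot y (B *m y).

(** The right-hand side is the energy of a line rotated by the parameter t, with
    minimum at t = 0, and r is proportional to its derivative there. *)
Lemma mobius_min_slope (F : realFieldType) (a b r U W : F) : 0 < a -> 0 <= b ->
  (forall t, U / a <= (U + 2 * t * r + t ^+ 2 * W) / (a + t ^+ 2 * b)) -> r = 0.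
Proof.
move=> a0 b0 h; pose k := a * W - b * U.
have key t : 0 <= t * (2 * a * r + t * k).
  have ab : 0 < a + t ^+ 2 * b by rewrite ltr_wpDr // mulr_ge0 ?sqr_ge0.
  have := h t; rewrite ler_pdivrMr // mulrAC ler_pdivlMr // /k; lra.
have k1 : 0 < `|k| + 1 by rewrite ltr_wpDl.
(* The step - r tau is small enough for the linear term to dominate. *)
pose tau := a / (`|k| + 1).
have tau0 : 0 < tau by rewrite divr_gt0.
have tk : tau * k < 2 * a.
  have : tau * (`|k| + 1) = a by rewrite divfK // gt_eqF.
  have := ler_norm k; nra.
have := key (- (r * tau)).
have -> : - (r * tau) * (2 * a * r + - (r * tau) * k) = - (tau * (2 * a - tau * k)) * r ^+ 2.
  ring.
rewrite mulNr oppr_ge0 pmulr_rle0; last by rewrite mulr_gt0 // subr_gt0.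
by move=> r0; apply/eqP; rewrite -sqrf_eq0 eq_le r0 sqr_ge0.
Qed.

(** Here v - u is orthogonal to ran Q, so the line of v is orthogonal to what is left
    of ran Q once the line of u is removed. *)
Lemma rank_one_exchange (R : realType) (N : nat) (Q : 'M[R[i]]_N) (u v : 'cV_N) :
  orthoproj Q -> u != 0 -> v != 0 -> Q *m u = u -> Q *m v = u ->
  orthoproj (Q - outer u + outer v) /\ \tr (Q - outer u + outer v) = \tr Q.
Proof.
move=> [QQ Qh] u0 v0 Qu Qv.
have ou := outer_orthoproj u0; have ov := outer_orthoproj v0.
have Qou := mul_outer Qu.
have /hermsymmx_adj hQh := Qh.
have ouQ : outer u *m Q = outer u by rewrite -[LHS]adjmxK adjmxM outer_adj hQh Qou outer_adj.
have q1 : (Q - outer u) *m outer v = 0.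
  have ouv : outer u *m v = u by rewrite -ouQ -mulmxA Qv outer_self.
  apply: mul_outer0; rewrite mulmxBl Qv ouv; exact: subrr.
have q2 : outer v *m (Q - outer u) = 0.
  by rewrite -[LHS]adjmxK adjmxM outer_adj adjmxB hQh outer_adj q1 adjmx0.
split; last by rewrite mxtraceD linearB /= !tr_outer // subrK.
split; last first.
  apply/hermsymmx_adj; rewrite adjmxD adjmxB; congr (_ - _ + _); [exact: hQh | |]; exact: outer_adj.
rewrite mulmxDl !(mulmxDr _ _ (outer v)) q1 q2 addr0 add0r ov.1.
by rewrite mulmxBl !mulmxBr QQ Qou ouQ ou.1 subrr subr0.
Qed.

(** First-order optimality: rotating a vector u of ran Q towards a vector w of
    ran (E - Q) stays admissible, so the derivative 2 Re <u, B w> vanishes. *)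
Lemma minimizer_stationary (R : realType) (N m : nat) (B V Q E : 'M[R[i]]_N) :
  B \is hermsymmx -> orthoproj_onto E V -> rb_minimizer B V m Q ->
  (E - Q) *m B *m Q = 0.
Proof.
move=> hB EV [[hQ trQ QV] Qmin]; have [QQ Qh] := hQ.
have [hE eqV] := EV; have EE := hE.1.
have EQ : E *m Q = Q by apply: proj_absorb EV QV.
have [hS QE] := orthoproj_sub hE hQ EQ.
set S := E - Q in hS *; have [SS /hermsymmx_adj Sh] := hS.
have QS : Q *m S = 0 by rewrite /S mulmxBr QE QQ subrr.
have ES : E *m S = S by rewrite /S mulmxBr EE EQ.
have ortho u w : Q *m u = u -> S *m w = w -> rdot u (B *m w) = 0.
  move=> Qu Sw; have Qw : Q *m w = 0 by rewrite -Sw mulmxA QS mul0mx.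
  have uw : rdot u w = 0 by rewrite -Qu rdot_herm // Qw rdot0r.
  have [->|u0] := eqVneq u 0; first by rewrite rdotC rdot0r.
  have a0 : 0 < cvnorm u ^+ 2 by rewrite exprn_gt0 // cvnorm_gt0.
  have b0 : 0 <= cvnorm w ^+ 2 by rewrite sqr_ge0.
  apply: (@mobius_min_slope _ _ _ _ (rdot u (B *m u)) (rdot w (B *m w)) a0 b0) => t.
  set v := u + t%:C *: w.
  have nv : cvnorm v ^+ 2 = cvnorm u ^+ 2 + t ^+ 2 * cvnorm w ^+ 2.
    rewrite -!rdotvv /v !(rdotDl, rdotDr, rdotZl, rdotZr) (rdotC w u) uw.
    by rewrite !mulr0 addr0 add0r mulrA.
  have v0 : v != 0.
    apply/eqP => v0; move/esym/eqP: nv; rewrite v0 cvnorm0 expr0n /=.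
    rewrite (paddr_eq0 (ltW a0) (mulr_ge0 (sqr_ge0 _) b0)) => /andP[/eqP h _].
    by rewrite h ltxx in a0.
  have Qv : Q *m v = u by rewrite mulmxDr -scalemxAr Qu Qw scaler0 addr0.
  have [hX trX] := rank_one_exchange hQ u0 v0 Qu Qv.
  have Eu : E *m u = u by rewrite -{1}Qu mulmxA EQ.
  have Eov : E *m outer v = outer v.
    have Ew : E *m w = w by rewrite -{1}Sw mulmxA ES.
    have Ev : E *m v = v by rewrite mulmxDr -scalemxAr Eu Ew.
    exact: mul_outer.
  have {}hX : rb_admissible V m (Q - outer u + outer v).
    split; first exact: hX.
    - by rewrite trX.
    - rewrite -eqV; have -> : Q - outer u + outer v = E *m (Q - outer u + outer v).
        by rewrite mulmxDr mulmxBr EQ Eov (mul_outer Eu).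
      by rewrite trmx_mul submxMl.
  have : rtr (B *m Q) <= rtr (B *m (Q - outer u + outer v)).
    by have := Qmin _ hX; rewrite lecE => /andP[_].
  rewrite mulmxDr mulmxBr (rtrD (_ - _)) (rtrD (B *m Q)) rtrN.
  rewrite [X in _ <= _ + X]rtr_outer [X in _ - X + _]rtr_outer nv.
  rewrite -addrA lerDl addrC subr_ge0 => h; apply: le_trans h _.
  rewrite le_eqVlt; apply/orP; left; apply/eqP; congr (_ / _).
  rewrite /v mulmxDr -scalemxAr !(rdotDl, rdotDr, rdotZl, rdotZr) (rdotC w) rdot_herm //.
  move: (rdot u (B *m u)) (rdot u (B *m w)) (rdot w (B *m w)) => x y z; ring.
(* Taking u = Q B S y makes the real inner product a squared norm. *)
have QBS : Q *m B *m S = 0.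
  apply: spnorm_eq0; apply: spnorm_le => // y; rewrite mul0r.
  have : rdot (Q *m (Q *m B *m S *m y)) (B *m (S *m y)) = 0.
    by apply: ortho; rewrite ?mulmxA ?QQ // -!mulmxA mulmxA SS.
  by rewrite rdot_herm // !mulmxA rdotvv => /eqP; rewrite sqrf_eq0 => /eqP ->.
move: hB Qh => /hermsymmx_adj hB /hermsymmx_adj Qh.
have -> : S *m B *m Q = (Q *m B *m S)^t* by rewrite !adjmxM Sh hB Qh mulmxA.
by rewrite QBS adjmx0.
Qed.

(** With C = B - a, both - P C P and P^perp (C - (b - a)) P^perp are positive
    semidefinite, and tr(C X) - tr(C P) is the sum of their traces against X^perp
    and X, plus (b - a) tr(P^perp X). *)
Lemma trace_gap (R : realType) (N : nat) (B P X : 'M[R[i]]_N) (a b : R) :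
  orthoproj P -> orthoproj X -> rtr X = rtr P -> B *m P = P *m B ->
  numrange_le P B a -> numrange_ge (perpmx P) B b -> a < b ->
  (b - a) * spnorm (perpmx P *m X) ^+ 2 <= rtr (B *m X) - rtr (B *m P).
Proof.
move=> hP hX trX BP ha hb ab; have [PP Ph] := hP; have [XX Xh] := hX.
have hP' := orthoproj_perp hP; set P' := perpmx P in hP' hb *.
have [P'P' P'h] := hP'; have [P'P PP'] := perpmx_mul0 hP.
have BP' : B *m P' = P' *m B by rewrite /P' /perpmx mulmxBr mulmxBl BP mulmx1 mul1mx.
pose C := B - a%:C%:M.
have rC y : rdot y (C *m y) = rdot y (B *m y) - a * cvnorm y ^+ 2.
  by rewrite mulmxBl mul_scalar_mx rdotDr rdotNr rdotZr rdotvv.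
have CP : C *m P = P *m C.
  by rewrite /C mulmxBl mulmxBr BP mul_scalar_mx mul_mx_scalar.
have CP' : C *m P' = P' *m C.
  by rewrite /C (mulmxBl B) (mulmxBr P') BP' mul_scalar_mx mul_mx_scalar.
have -> : rtr (B *m X) - rtr (B *m P) = rtr (C *m X) - rtr (C *m P).
  by rewrite /C !mulmxBl !mul_scalar_mx !rtrD !rtrN !rtrZ trX; ring.
have h1 : 0 <= rtr (- (P *m C *m P) *m perpmx X).
  apply: rtr_conj_ge0 => [|y]; first exact: orthoproj_perp.
  rewrite mulNmx rdotNr oppr_ge0 -!mulmxA -rdot_herm // rC subr_le0 ha //.
  by rewrite mulmxA PP.
have h2 : 0 <= rtr (P' *m (C - (b - a)%:C%:M) *m P' *m X).
  apply: rtr_conj_ge0 => // y; rewrite -!mulmxA -rdot_herm //.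
  rewrite (mulmxBl C) mul_scalar_mx (rdotDr _ (C *m _)) rdotNr rdotZr rC rdotvv.
  have := hb (P' *m y); rewrite mulmxA P'P' => /(_ erefl); lra.
have h3 : spnorm (P' *m X) ^+ 2 <= rtr (P' *m X).
  apply: le_trans (spnorm_le_frob _) _; rewrite adjmxM.
  move/hermsymmx_adj: P'h => ->; move/hermsymmx_adj: Xh => ->.
  by rewrite -mulmxA (mulmxA P') P'P' [leLHS]rtrC -mulmxA XX.
have e1 : P *m C *m P = C *m P by rewrite -CP -mulmxA PP.
have e2 : P' *m (C - (b - a)%:C%:M) *m P' = C *m P' - (b - a)%:C *: P'.
  by rewrite (mulmxBr P') mulmxBl -CP' -[C *m P' *m P']mulmxA P'P' mul_mx_scalar -scalemxAl P'P'.
rewrite e2 (mulmxBl (C *m P')) rtrD rtrN -scalemxAl rtrZ in h2.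
rewrite e1 mulNmx rtrN /perpmx mulmxBr mulmx1 rtrD rtrN in h1.
have e3 : rtr (C *m X) = rtr (C *m P *m X) + rtr (C *m P' *m X).
  by rewrite -rtrD -mulmxDl -mulmxDr /P' /perpmx addrC subrK mulmx1.
have : (b - a) * spnorm (P' *m X) ^+ 2 <= (b - a) * rtr (P' *m X).
  by rewrite ler_wpM2l // subr_ge0 ltW.
move/le_trans; apply; rewrite e3; move: h1 h2.
move: (rtr (C *m P *m X)) (rtr (C *m P)) (rtr (C *m P' *m X)) (rtr (P' *m X)) => x y z t.
clear -a b; lra.
Qed.

(** * The gap between two compressions *)

Lemma numrange_geN (R : realType) (N : nat) (E B : 'M[R[i]]_N) (b : R) :
  numrange_ge E B b <-> numrange_le E (- B) (- b).
Proof.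
by split=> h y /h; rewrite mulNmx rdotNr mulNr lerN2.
Qed.

Lemma numrange_leN (R : realType) (N : nat) (E B : 'M[R[i]]_N) (b : R) :
  numrange_le E B b <-> numrange_ge E (- B) (- b).
Proof.
by split=> h y /h; rewrite mulNmx rdotNr mulNr lerN2.
Qed.

Lemma restr_spectrum_le (R : realType) (N : nat) (E B : 'M[R[i]]_N) (a : R) z :
  orthoproj E -> numrange_le E B a -> restr_spectrum E B z -> complex.Re z <= a.
Proof.
move=> [EE Eh] h [y [y0 Ey Ez]].
have := h y Ey; rewrite -{1}Ey (rdot_herm _ _ Eh) Ez.
have -> : rdot y (z *: y) = complex.Re z * cvnorm y ^+ 2.
  rewrite /rdot -scalemxAr mxE adj_self !mxE eqxx mulr1n.
  by case: z {Ez} => c e /=; ring.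
by rewrite ler_pM2r // exprn_gt0 // cvnorm_gt0.
Qed.

Lemma restr_spectrumN (R : realType) (N : nat) (E B : 'M[R[i]]_N) z :
  restr_spectrum E B z -> restr_spectrum E (- B) (- z).
Proof.
move=> [y [y0 Ey Ez]]; exists y; split=> //.
by rewrite mulNmx mulmxN Ez scaleNr.
Qed.

Lemma restr_spectrum_ge (R : realType) (N : nat) (E B : 'M[R[i]]_N) (b : R) z :
  orthoproj E -> numrange_ge E B b -> restr_spectrum E B z -> b <= complex.Re z.
Proof.
move=> hE /numrange_geN h /restr_spectrumN hz.
by have := restr_spectrum_le hE h hz; rewrite raddfN lerN2.
Qed.

Lemma restr_spectrum0 (R : realType) (N : nat) (B : 'M[R[i]]_N) :
  restr_spectrum 0 B = set0.
Proof.
apply/seteqP; split=> // z [y [y0]]; rewrite mul0mx => /esym y00.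
by rewrite y00 eqxx in y0.
Qed.

Lemma min_restr_spectrum (R : realType) (N : nat) (E B : 'M[R[i]]_N) :
  orthoproj E -> E != 0 -> B \is hermsymmx ->
  exists2 b : R, restr_spectrum E B b%:C & numrange_ge E B b.
Proof.
move=> hE E0 hB; have [b [v [v0 Ev EBv hb]]] := rayleigh_min_on hE E0 hB.
by exists b => //; exists v.
Qed.

Lemma max_restr_spectrum (R : realType) (N : nat) (E B : 'M[R[i]]_N) :
  orthoproj E -> E != 0 -> B \is hermsymmx ->
  exists2 a : R, restr_spectrum E B a%:C & numrange_le E B a.
Proof.
move=> hE E0 hB; have [b sb hb] := min_restr_spectrum hE E0 (hermN hB).
exists (- b); last by apply/numrange_leN; rewrite opprK.
by have := restr_spectrumN sb; rewrite opprK rmorphN.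
Qed.

Lemma Re_le_normc (R : realType) (z : R[i]) : `|complex.Re z| <= normc z.
Proof.
case: z => x y /=; rewrite -sqrtr_sqr ler_wsqrtr // lerDl sqr_ge0 //.
Qed.

Lemma spectral_gap_pinfty (R : realType) (N : nat) (B E F Q : 'M[R[i]]_N) :
  E = 0 \/ F *m perpmx Q = 0 -> spectral_gap B E F Q = +oo%E.
Proof.
rewrite /spectral_gap => -[->|->]; rewrite restr_spectrum0 -[RHS]ereal_inf0.
  by congr ereal_inf; apply/seteqP; split=> // _ [z []].
by congr ereal_inf; apply/seteqP; split=> // _ [z _ [w []]].
Qed.

(** When the two compressions are separated, the distance of their spectra is
    attained at the largest eigenvalue of the first and the smallest eigenvalue
    of the second; the first alternative is the case of an empty spectrum. *)
Lemma spectral_gapP (R : realType) (N : nat) (B E F Q : 'M[R[i]]_N) (a b : R) :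
  orthoproj E -> orthoproj (F *m perpmx Q) -> B \is hermsymmx ->
  numrange_le E B a -> numrange_ge (F *m perpmx Q) B b -> a < b ->
  (E = 0 \/ F *m perpmx Q = 0) \/
  exists2 ab : R * R, (ab.1 <= a) && (b <= ab.2) &
    [/\ numrange_le E B ab.1, numrange_ge (F *m perpmx Q) B ab.2
      & spectral_gap B E F Q = (ab.2 - ab.1)%:E].
Proof.
rewrite /spectral_gap; set S := F *m perpmx Q => hE hS hB ha hb ab.
have [E0|E0] := eqVneq E 0; first by left; left.
have [S0|S0] := eqVneq S 0; first by left; right.
right; have [a' sa ha'] := max_restr_spectrum hE E0 hB.
have [b' sb hb'] := min_restr_spectrum hS S0 hB.
have aa' : a' <= a := restr_spectrum_le hE ha sa.
have bb' : b <= b' := restr_spectrum_ge hS hb sb.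
have ab' : a' < b' by apply: le_lt_trans aa' (lt_le_trans ab bb').
exists (a', b'); first by rewrite aa'.
split=> //; apply/le_anti/andP; split.
  apply: ereal_inf_lbound; exists a'%:C => //; exists b'%:C => //.
  rewrite -rmorphB /= expr0n addr0 sqrtr_sqr distrC ger0_norm //.
  by rewrite subr_ge0 ltW.
apply: le_ereal_inf_tmp => _ [z hz [w hw <-]]; rewrite lee_fin.
apply: le_trans (Re_le_normc _); rewrite raddfB distrC.
apply: le_trans (ler_norm _).
by apply: lerB; [exact: restr_spectrum_ge hS hb' hw | exact: restr_spectrum_le hE ha' hz].
Qed.

Lemma rb_factor_pinfty (R : realType) (N : nat) (B E F Q : 'M[R[i]]_N) :
  spectral_gap B E F Q = +oo%E -> rb_factor B E F Q = 1.
Proof.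
by move=> e; rewrite /rb_factor e expe2 mulyy invey mule0 addr0 sqrtr1.
Qed.

Lemma rb_factor_fin (R : realType) (N : nat) (B E F Q : 'M[R[i]]_N) (h : R) :
  0 < h -> spectral_gap B E F Q = h%:E ->
  rb_factor B E F Q = Num.sqrt (1 + res2 B F / h ^+ 2).
Proof.
move=> h0 e; rewrite /rb_factor e -EFin_expe inver expf_eq0 /= gt_eqF //.
Qed.

(** * The error bound for a single matrix *)

(** X = S P satisfies X B - S B X = S C P on ran P.  If v is a top singular vector of
    X and u = X v, pairing the equation with u and v leaves at least
    s^2 (b - a) |v|^2 on one side and at most s |S C P| |v|^2 on the other. *)
Lemma sylvester_bound (R : realType) (N : nat) (B C P S : 'M[R[i]]_N) (a b : R) :
  orthoproj P -> orthoproj S -> B \is hermsymmx -> B *m P = P *m B ->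
  S *m B = S *m B *m S + S *m C ->
  numrange_le P B a -> numrange_ge S B b -> a < b ->
  (b - a) * spnorm (S *m P) <= spnorm (S *m C *m P).
Proof.
move=> hP hS hB BP SB ha hb ab; have [PP Ph] := hP; have [SS Sh] := hS.
set X := S *m P; set Y := S *m C *m P.
have [X0|X0] := eqVneq X 0; first by rewrite X0 spnorm0 mulr0 spnorm_ge0.
have N0 : (0 < N)%N.
  by move: X0; case: (N) X => // X /eqP[]; apply/matrixP => -[].
have [s [v [s0 v0 sv sX]]] := top_singular_vector X N0.
have {}s0 : 0 < s.
  rewrite lt_neqAle s0 andbT eq_sym; apply: contraNneq X0 => s0'; apply/eqP.
  by apply: spnorm_eq0; apply: spnorm_le => // y; rewrite -s0' sX.
have PX : P *m X^t* = X^t*.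
  by rewrite /X adjmxM mulmxA; move/hermsymmx_adj: Ph => ->; rewrite PP.
(* v = s^-2 X^* X v, and ran X^* lies in ran P. *)
have Pv : P *m v = v.
  have : (s ^+ 2)%:C *: (P *m v - v) = 0.
    by rewrite scalerBr scalemxAr -sv mulmxA PX subrr.
  move/eqP; rewrite scaler_eq0 subr_eq0 => /orP[|/eqP//].
  by rewrite -[0]/(0%:C) (inj_eq (@complexI _)) sqrf_eq0 gt_eqF.
set u := X *m v; have Su : S *m u = u by rewrite /u /X !mulmxA SS.
have uu : cvnorm u ^+ 2 = s ^+ 2 * cvnorm v ^+ 2.
  by rewrite -!rdotvv rdot_adj sv rdotZr.
have h1 : rdot u (X *m (B *m v)) <= s ^+ 2 * (a * cvnorm v ^+ 2).
  rewrite rdotC rdot_adj sv rdotZr rdotC; apply: ler_wpM2l; first exact: sqr_ge0.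
  exact: ha.
have h2 : b * (s ^+ 2 * cvnorm v ^+ 2) <= rdot u (B *m u).
  by rewrite -uu; exact: hb.
have XY : X *m (B *m v) = S *m (B *m u) + Y *m v.
  have uS : u = S *m v by rewrite /u /X -mulmxA Pv.
  have -> : X *m (B *m v) = S *m B *m v.
    by rewrite /X -(mulmxA S P) (mulmxA P B) -BP -(mulmxA B P) Pv mulmxA.
  by rewrite uS /Y -(mulmxA _ P v) Pv {1}SB mulmxDl !mulmxA.
have h3 : - rdot u (Y *m v) <= s * cvnorm v ^+ 2 * spnorm Y.
  rewrite -rdotNr; apply: le_trans (rdot_le _ _) _; rewrite cvnormN.
  have us : cvnorm u = s * cvnorm v.
    apply/eqP; rewrite -(@eqrXn2 _ 2) ?cvnorm_ge0 //; first by rewrite exprMn uu.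
    by apply: mulr_ge0; [exact: ltW | exact: cvnorm_ge0].
  rewrite us expr2 -!mulrA; apply: ler_wpM2l; first exact: ltW.
  apply: ler_wpM2l; first exact: cvnorm_ge0.
  by rewrite mulrC; exact: le_spnorm.
move: h1; rewrite XY rdotDr -(rdot_herm _ _ Sh) Su => h1.
have key : s * cvnorm v ^+ 2 * ((b - a) * s) <= s * cvnorm v ^+ 2 * spnorm Y.
  apply: le_trans h3; move: h1 h2.
  move: (rdot u (B *m u)) (rdot u _) (cvnorm v) => x y z; clear -a b s; lra.
have {key} : (b - a) * s <= spnorm Y.
  by rewrite -(ler_pM2l (_ : 0 < s * cvnorm v ^+ 2)) // mulr_gt0 // exprn_gt0 // cvnorm_gt0.
apply: le_trans; apply: ler_wpM2l; first by rewrite subr_ge0 ltW.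
by apply: spnorm_le => //; exact: ltW.
Qed.

(** Pythagoras for Q^perp P = E^perp P + (E - Q) P. *)
Lemma perp_split_bound (R : realType) (N : nat) (P Q E : 'M[R[i]]_N) (c : R) :
  orthoproj E -> orthoproj P -> E *m Q = Q -> 0 <= c ->
  spnorm ((E - Q) *m P) <= c * spnorm (perpmx E *m P) ->
  spnorm (perpmx Q *m P) <= Num.sqrt (1 + c ^+ 2) * spnorm (perpmx E *m P).
Proof.
move=> hE [PP Ph] EQ c0; set t := spnorm (perpmx E *m P) => hc.
have t0 : 0 <= t := spnorm_ge0 _.
have f0 : 0 <= 1 + c ^+ 2 by rewrite addr_ge0 // sqr_ge0.
have ft0 : 0 <= Num.sqrt (1 + c ^+ 2) * t by rewrite mulr_ge0 // sqrtr_ge0.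
apply: spnorm_le ft0 _ => y.
rewrite -(@ler_pXn2r _ 2) ?nnegrE ?mulr_ge0 ?cvnorm_ge0 ?sqrtr_ge0 //.
rewrite (cvnorm_pythag _ hE) !exprMn (sqr_sqrtr f0).
have -> : E *m (perpmx Q *m P *m y) = (E - Q) *m P *m y.
  by rewrite !mulmxA {1}/perpmx mulmxBr mulmx1 EQ.
have -> : perpmx E *m (perpmx Q *m P *m y) = perpmx E *m P *m y.
  rewrite !mulmxA {2}/perpmx mulmxBr mulmx1 -EQ mulmxA (perpmx_mul0 hE).1.
  by rewrite mul0mx subr0.
rewrite mulrDl mul1r mulrDl addrC; apply: lerD; rewrite -!exprMn.
  rewrite lerXn2r ?nnegrE ?cvnorm_ge0 ?mulr_ge0 ?cvnorm_ge0 //; exact: le_spnorm.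
have ct0 : 0 <= c * t by rewrite mulr_ge0.
rewrite lerXn2r ?nnegrE ?cvnorm_ge0 //; first by rewrite mulr_ge0 ?cvnorm_ge0.
by apply: le_trans (le_spnorm _ _) _; apply: ler_wpM2r (cvnorm_ge0 _) _ _ hc.
Qed.

(** Stationarity reads (E - Q) B = (E - Q) B (E - Q) + (E - Q) B E^perp, which is the
    hypothesis of [sylvester_bound]. *)
Lemma rb_error_bound (R : realType) (N : nat) (B P Q E : 'M[R[i]]_N) (a b : R) :
  orthoproj P -> orthoproj Q -> orthoproj E -> B \is hermsymmx ->
  \rank P = \rank Q -> B *m P = P *m B -> E *m Q = Q -> orthoproj (E - Q) ->
  (E - Q) *m B *m Q = 0 ->
  numrange_le P B a -> numrange_ge (E - Q) B b -> a < b ->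
  spnorm (Q - P) <= rb_factor B P E Q * spnorm (perpmx E *m P).
Proof.
move=> hP hQ hE hB rk BP EQ hS SBQ ha hb ab.
apply: le_trans (proj_dist hP hQ rk) _.
have ES : E *m perpmx Q = E - Q by rewrite /perpmx mulmxBr mulmx1 EQ.
have := @spectral_gapP _ _ B P E Q a b hP; rewrite ES => /(_ hS hB ha hb ab).
case=> [z0|[[a' b'] /andP[/= aa' bb'] [ha' hb' gapE]]].
  rewrite rb_factor_pinfty; last by apply: spectral_gap_pinfty; rewrite ES.
  have := @perp_split_bound _ _ P Q E 0 hE hP EQ (lexx 0).
  rewrite expr0n addr0 sqrtr1 mul0r; apply.
  by case: z0 => ->; rewrite ?mulmx0 ?mul0mx spnorm0.
have ab' : a' < b' := le_lt_trans aa' (lt_le_trans ab bb').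
have h0 : 0 < b' - a' by rewrite subr_gt0.
have aux (x y t : R) : (b' - a') * x <= y * t -> x <= y / (b' - a') * t.
  by rewrite mulrAC (ler_pdivlMr _ _ h0) mulrC.
rewrite (rb_factor_fin h0 gapE) /res2 -expr_div_n.
apply: perp_split_bound => //; first by rewrite divr_ge0 ?spnorm_ge0 // ltW.
apply: aux.
have SB : (E - Q) *m B = (E - Q) *m B *m (E - Q) + (E - Q) *m (B *m perpmx E).
  rewrite mulmxA -mulmxDr /perpmx.
  have -> : E - Q + (1%:M - E) = 1%:M - Q by rewrite addrC addrA subrK.
  by rewrite mulmxBr mulmx1 SBQ subr0.
apply: le_trans (sylvester_bound hP hS hB BP SB ha' hb' ab') _.
have SE : (E - Q) *m E = E - Q.
  by rewrite mulmxBl hE.1 (orthoproj_sub hE hQ EQ).2.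
have -> : (E - Q) *m (B *m perpmx E) *m P = (E - Q) *m (E *m B *m perpmx E *m (perpmx E *m P)).
  by rewrite !mulmxA SE -(mulmxA _ (perpmx E) (perpmx E)) (orthoproj_perp hE).1.
apply: le_trans (spnormM _ _) _; apply: le_trans (ler_wpM2r (spnorm_ge0 _) (spnorm_orthoproj hS)) _.
by rewrite mul1r; exact: spnormM.
Qed.

(** * Remainders of multivariate power series *)

Lemma enorm_ge0 (R : realType) (d : nat) (x : 'rV[R]_d) : 0 <= enorm x.
Proof. exact: sqrtr_ge0. Qed.

Lemma enorm0 (R : realType) (d : nat) : enorm (0 : 'rV[R]_d) = 0.
Proof.
by rewrite /enorm big1 ?sqrtr0 // => k _; rewrite mxE expr0n.
Qed.

Lemma coord_le_enorm (R : realType) (d : nat) (x : 'rV[R]_d) k : `|x 0 k| <= enorm x.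
Proof.
rewrite /enorm -sqrtr_sqr; apply: ler_wsqrtr; rewrite (bigD1 k) //= lerDl.
by apply: sumr_ge0 => j _; exact: sqr_ge0.
Qed.

Lemma enorm_const (R : realType) (d : nat) (s : R) : 0 <= s ->
  enorm (const_mx s : 'rV[R]_d) <= s * d%:R.
Proof.
move=> s0; have sd : 0 <= s * d%:R by rewrite mulr_ge0.
rewrite /enorm -[leRHS]ger0_norm // -sqrtr_sqr; apply: ler_wsqrtr.
under eq_bigr do rewrite mxE.
rewrite sumr_const card_ord -(mulr_natr (_ ^+ 2)) exprMn; apply: ler_wpM2l; first exact: sqr_ge0.
by rewrite -natrX ler_nat; case: (d) => // k; rewrite expnS expn1 leq_pmulr.
Qed.

Lemma cvg_enorm (R : realType) (d : nat) (mu1 : 'rV[R]_d) :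
  (fun mu => enorm (mu - mu1)) @ mu1 --> (0 : R).
Proof.
apply/(@cvgr0Pnorm_le _ _ _ (nbhs mu1) (nbhs_filter mu1)) => e e0.
pose del := e / d.+1%:R; have del0 : 0 < del by rewrite divr_gt0.
have ed : e = del * d.+1%:R by rewrite /del divfK.
clearbody del; rewrite ed.
apply/nbhs_ballP; exists del => //= mu [_ hmu].
rewrite ger0_norm ?enorm_ge0 // /enorm -[leRHS]gtr0_norm ?mulr_gt0 // -sqrtr_sqr.
apply: ler_wsqrtr.
apply: (@le_trans _ _ (\sum_(k < d) del ^+ 2)).
  apply: ler_sum => k _; rewrite -[leLHS]real_normK ?num_real //.
  rewrite lerXn2r ?nnegrE ?(ltW del0) // ltW //.
  by have := hmu 0 k; rewrite /ball /= distrC !mxE.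
rewrite sumr_const card_ord -(mulr_natr (_ ^+ 2)) exprMn; apply: ler_wpM2l; first exact: sqr_ge0.
rewrite -natrX ler_nat expnS expn1; apply: leq_trans (leqnSn d) _; exact: leq_pmulr.
Qed.

Lemma mpow_le (R : realType) (d p : nat) (x : 'rV[R]_d) (beta : {ffun 'I_d -> nat}) :
  beta \in mindex d p -> `|mpow x beta| <= enorm x ^+ p.
Proof.
rewrite mem_mindex => /eqP <-; rewrite /mpow normr_prod -prodrXr.
apply: ler_prod => k _; rewrite normr_ge0 normrX /=.
by rewrite lerXn2r ?nnegrE ?enorm_ge0 ?coord_le_enorm.
Qed.

Lemma mpow_const (R : realType) (d p : nat) (s : R) (beta : {ffun 'I_d -> nat}) :
  beta \in mindex d p -> mpow (const_mx s) beta = s ^+ p.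
Proof.
rewrite mem_mindex => /eqP <-; rewrite /mpow -prodrXr.
by apply: eq_bigr => k _; rewrite mxE.
Qed.

Definition hom_part (R : realType) (d N : nat) (c : {ffun 'I_d -> nat} -> 'M[R[i]]_N)
    (p : nat) (x : 'rV[R]_d) : 'M[R[i]]_N :=
  \sum_(beta <- mindex d p) (mpow x beta)%:C *: c beta.

Lemma hom_part_le (R : realType) (d N : nat) (c : {ffun 'I_d -> nat} -> 'M[R[i]]_N)
    (p : nat) (x : 'rV[R]_d) :
  spnorm (hom_part c p x) <= enorm x ^+ p * coef_norm_sum c p.
Proof.
apply: le_trans (spnorm_sum _ _) _; rewrite /coef_norm_sum mulr_sumr.
rewrite big_seq [leRHS]big_seq; apply: ler_sum => beta hb.
apply: le_trans (spnormZ_le _ _) _; apply: ler_wpM2r; first exact: spnorm_ge0.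
exact: mpow_le.
Qed.

Lemma coef_norm_sum_ge0 (R : realType) (d N : nat) (c : {ffun 'I_d -> nat} -> 'M[R[i]]_N)
    (p : nat) : 0 <= coef_norm_sum c p.
Proof. by apply: sumr_ge0 => b _; exact: spnorm_ge0. Qed.

(** The radius leaves room for the point with all coordinates equal to some s > 0,
    at which every monomial of degree p equals s^p.  Hence sum_p s^p C_p converges,
    where C_p is the sum of the norms of the coefficients of degree p, and for
    |x| <= s the terms of degree at least m are dominated by
    (|x| / s)^m sum_p s^p C_p. *)
Lemma taylor_remainder (R : realType) (d N : nat) (f : 'rV[R]_d -> 'M[R[i]]_N)
    (mu1 : 'rV[R]_d) (c : {ffun 'I_d -> nat} -> 'M[R[i]]_N) (m : nat) :
  power_series_at f mu1 c ->
  exists2 C : R, 0 <= C & \forall mu \near mu1,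
    spnorm (f mu - \sum_(0 <= p < m) hom_part c p (mu - mu1)) <= C * enorm (mu - mu1) ^+ m.
Proof.
move=> [r r0 hr]; pose s := r / d.+1%:R.
have s0 : 0 < s by rewrite divr_gt0.
have sr : s * d.+1%:R = r by rewrite /s divfK.
pose u p := s ^+ p * coef_norm_sum c p.
have u0 p : 0 <= u p by rewrite mulr_ge0 ?exprn_ge0 ?coef_norm_sum_ge0 // ltW.
have cu : cvgn (series u).
  (* |const_mx s| <= s d < s (d + 1) = r. *)
  have [|+ _] := hr (mu1 + const_mx s).
    rewrite addrC addKr; apply: le_lt_trans (enorm_const _ (ltW s0)) _.
    by rewrite -sr ltr_pM2l // ltr_nat.
  rewrite (_ : series _ = series u) //; congr series; apply/funext => p.
  rewrite /u /coef_norm_sum mulr_sumr big_seq [RHS]big_seq; apply: eq_bigr => b hb.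
  by rewrite addrC addKr (mpow_const _ hb) ger0_norm // exprn_ge0 // ltW.
pose S := limn (series u).
have nd : nondecreasing_seq (series u) by apply: nondecreasing_series.
have uS k : series u k <= S by apply: nondecreasing_cvgn_le.
have S0 : 0 <= S by apply: le_trans (uS 0%N); rewrite /series /= big_geq.
exists (S / s ^+ m); first by rewrite divr_ge0 // exprn_ge0 // ltW.
have sr' : s <= r by rewrite -sr ler_peMr ?ler1n // ltW.
have h1 : \forall mu \near mu1, enorm (mu - mu1) < s.
  have := @cvg_enorm R d mu1; move/cvgrPdist_lt => /(_ s s0).
  by apply: filterS => mu; rewrite distrC subr0 ger0_norm ?enorm_ge0.
near=> mu.
have xs : enorm (mu - mu1) < s by near: mu.
set x := mu - mu1 in xs *.
have [_ hf] := hr mu (lt_le_trans xs sr').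
have tail k : (m <= k)%N ->
    \sum_(m <= p < k) spnorm (hom_part c p x) <= S / s ^+ m * enorm x ^+ m.
  move=> mk; apply: (@le_trans _ _ (\sum_(m <= p < k) enorm x ^+ m / s ^+ m * u p)).
    rewrite big_seq [leRHS]big_seq; apply: ler_sum => p; rewrite mem_index_iota => /andP[mp _].
    apply: le_trans (hom_part_le _ _ _) _; rewrite /u mulrA.
    apply: ler_wpM2r; first exact: coef_norm_sum_ge0.
    rewrite -{1 2}(subnKC mp) !exprD mulrA divfK ?expf_neq0 ?gt_eqF //.
    apply: ler_wpM2l; first by rewrite exprn_ge0 // enorm_ge0.
    by rewrite lerXn2r ?nnegrE ?enorm_ge0 // ltW.
  rewrite -mulr_sumr mulrC -mulrA [X in _ <= S * X]mulrC; apply: ler_wpM2r.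
    by rewrite divr_ge0 ?exprn_ge0 ?enorm_ge0 // ltW.
  apply: le_trans (uS k); rewrite /series /= (big_cat_nat (leq0n m) mk) //= lerDr.
  by apply: sumr_ge0 => p _.
have hf' : (fun k => spnorm (f mu - \sum_(0 <= p < k) hom_part c p x)
      + S / s ^+ m * enorm x ^+ m) @ \oo --> 0 + S / s ^+ m * enorm x ^+ m.
  by apply: cvgD; [exact: hf | exact: cvg_cst].
rewrite add0r in hf'; apply: (cvgr_to_ge hf'); near=> k.
have mk : (m <= k)%N by near: k; exact: nbhs_infty_ge.
have -> : f mu - \sum_(0 <= p < m) hom_part c p x =
    (f mu - \sum_(0 <= p < k) hom_part c p x) + \sum_(m <= p < k) hom_part c p x.
  by rewrite (big_cat_nat (leq0n m) mk) //= opprD addrA subrK.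
apply: le_trans (spnormD _ _) _; rewrite lerD2l.
by apply: le_trans (spnorm_sum _ _) _; exact: tail.
Unshelve. all: by end_near.
Qed.

(** * Limits of matrix-valued functions *)

Definition spcvg (R : realType) (T : Type) (N : nat) (f : T -> 'M[R[i]]_N)
    (F : set_system T) (L : 'M[R[i]]_N) : Prop :=
  (fun mu => spnorm (f mu - L)) @ F --> (0 : R).

Lemma cvg0_le (R : realType) (T : Type) (F : set_system T) {FF : Filter F} (u v : T -> R) :
  (\forall mu \near F, 0 <= u mu <= v mu) -> v @ F --> (0 : R) ->
  u @ F --> (0 : R).
Proof. by move=> h hv; apply: (squeeze_cvgr h) => //; exact: cvg_cst. Qed.

Lemma spcvg_cst (R : realType) (T : Type) (N : nat) (F : set_system T)
    {FF : Filter F} (L : 'M[R[i]]_N) :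
  spcvg (fun=> L) F L.
Proof. by rewrite /spcvg subrr spnorm0; exact: cvg_cst. Qed.

Lemma spcvgD (R : realType) (T : Type) (N : nat) (F : set_system T)
    {FF : Filter F} (f g : T -> 'M[R[i]]_N)
    (L M : 'M[R[i]]_N) :
  spcvg f F L -> spcvg g F M -> spcvg (fun mu => f mu + g mu) F (L + M).
Proof.
move=> hf hg.
have h : (fun mu => spnorm (f mu - L) + spnorm (g mu - M)) @ F --> (0 : R).
  by rewrite -[X in _ --> X](addr0 0); apply: cvgD; [exact: hf | exact: hg].
apply: cvg0_le h; apply: nearW => mu; rewrite spnorm_ge0 /=.
have -> : f mu + g mu - (L + M) = (f mu - L) + (g mu - M) by rewrite opprD addrACA.
exact: spnormD.
Qed.

Lemma spcvgN (R : realType) (T : Type) (N : nat) (F : set_system T)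
    {FF : Filter F} (f : T -> 'M[R[i]]_N)
    (L : 'M[R[i]]_N) :
  spcvg f F L -> spcvg (fun mu => - f mu) F (- L).
Proof.
move=> h; apply: cvg0_le h; apply: nearW => mu; by rewrite spnorm_ge0 /= -opprD spnormN.
Qed.

Lemma spcvgB (R : realType) (T : Type) (N : nat) (F : set_system T)
    {FF : Filter F} (f g : T -> 'M[R[i]]_N)
    (L M : 'M[R[i]]_N) :
  spcvg f F L -> spcvg g F M -> spcvg (fun mu => f mu - g mu) F (L - M).
Proof. by move=> hf /spcvgN; exact: spcvgD. Qed.

Lemma spcvgM (R : realType) (T : Type) (N : nat) (F : set_system T)
    {FF : Filter F} (f g : T -> 'M[R[i]]_N)
    (L M : 'M[R[i]]_N) :
  spcvg f F L -> spcvg g F M -> spcvg (fun mu => f mu *m g mu) F (L *m M).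
Proof.
move=> hf hg.
have h : (fun mu => spnorm (f mu - L) * spnorm (g mu - M) +
    (spnorm (f mu - L) * spnorm M + spnorm L * spnorm (g mu - M))) @ F --> (0 : R).
  rewrite [X in _ --> X](_ : _ = 0 * 0 + (0 * spnorm M + spnorm L * 0)); last first.
    by rewrite !mul0r mulr0 !addr0.
  apply: cvgD; first by apply: cvgM; [exact: hf | exact: hg].
  apply: cvgD; apply: cvgM; [exact: hf | exact: cvg_cst | exact: cvg_cst | exact: hg].
apply: cvg0_le h; apply: nearW => mu.
rewrite spnorm_ge0 /=.
have -> : f mu *m g mu - L *m M =
   (f mu - L) *m (g mu - M) + ((f mu - L) *m M + L *m (g mu - M)).
  by rewrite (mulmxBr (f mu - L)) addrA subrK mulmxBl mulmxBr addrA subrK.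
apply: le_trans (spnormD _ _) _; apply: lerD; first exact: spnormM.
by apply: le_trans (spnormD _ _) _; apply: lerD; exact: spnormM.
Qed.

Lemma spcvg_norm (R : realType) (T : Type) (N : nat) (F : set_system T)
    {FF : Filter F} (f : T -> 'M[R[i]]_N)
    (L : 'M[R[i]]_N) :
  spcvg f F L -> (fun mu => spnorm (f mu)) @ F --> (spnorm L : R).
Proof.
move=> hf.
have hp : (fun mu => spnorm L + spnorm (f mu - L)) @ F --> (spnorm L : R).
  by rewrite -[X in _ --> X]addr0; apply: cvgD => //; exact: cvg_cst.
have hm : (fun mu => spnorm L - spnorm (f mu - L)) @ F --> (spnorm L : R).
  by rewrite -[X in _ --> X]subr0; apply: cvgB => //; exact: cvg_cst.
apply: (squeeze_cvgr _ hm hp); apply: nearW => mu /=; apply/andP; split.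
  rewrite lerBlDr -(spnormN (f mu - L)) opprB.
  by apply: le_trans (spnormD _ _); rewrite addrC subrK.
by apply: le_trans (spnormD _ _); rewrite addrC subrK.
Qed.

(** The constant term is the value at the center, by the remainder estimate of
    order 1. *)
Lemma analytic_spcvg (R : realType) (d N : nat) (f : 'rV[R]_d -> 'M[R[i]]_N)
    (mu0 : 'rV[R]_d) (c : {ffun 'I_d -> nat} -> 'M[R[i]]_N) :
  power_series_at f mu0 c -> f mu0 = hom_part c 0 0 /\ spcvg f (nbhs mu0) (f mu0).
Proof.
move=> hf; have [C C0 hC] := taylor_remainder 1 hf.
have h0 mu : hom_part c 0 mu = hom_part c 0 0.
  rewrite /hom_part big_seq [RHS]big_seq; apply: eq_bigr => b.
  rewrite mem_mindex sum_nat_eq0 => /forallP b0; congr (_%:C *: _).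
  by apply: eq_bigr => k _; rewrite (eqP (b0 k)).
have e0 : f mu0 = hom_part c 0 0.
  apply/eqP; rewrite -subr_eq0; apply/eqP; apply: spnorm_eq0.
  have := nbhs_singleton hC.
  by rewrite big_nat1 subrr enorm0 expr1 mulr0.
split=> //; have FF : Filter (nbhs mu0) := nbhs_filter mu0.
have hx : (fun mu => C * enorm (mu - mu0)) @ mu0 --> (0 : R).
  rewrite -[0](mulr0 C); apply: (@cvgM _ _ (nbhs mu0) FF) (@cvg_enorm R d mu0).
  by apply: (@cvg_cst _ C _ (nbhs mu0) FF).
apply: (@cvg0_le _ _ (nbhs mu0) FF _ _ _ hx); apply: filterS hC => mu.
by rewrite big_nat1 h0 expr1 spnorm_ge0 -e0.
Qed.

(** For y in ran E the form <y, (B - a) y> is that of E (B - a) E, which depends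
    continuously on E and B and is nonpositive at the limit. *)
Lemma numrange_le_perturb (R : realType) (T : Type) (N : nat) (F : set_system T)
    {FF : Filter F} (E B : T -> 'M[R[i]]_N) (E0 B0 : 'M[R[i]]_N) (a : R) :
  orthoproj E0 -> (\forall mu \near F, orthoproj (E mu)) ->
  spcvg E F E0 -> spcvg B F B0 -> numrange_le E0 B0 a ->
  exists2 e : T -> R, e @ F --> (0 : R) &
    \forall mu \near F, numrange_le (E mu) (B mu) (a + e mu).
Proof.
move=> hE0 hE cE cB ha.
pose W (G X : 'M[R[i]]_N) := G *m (X - a%:C%:M) *m G.
have rW (G X : 'M[R[i]]_N) (y : 'cV_N) : orthoproj G ->
    rdot y (W G X *m y) = rdot (G *m y) (X *m (G *m y)) - a * cvnorm (G *m y) ^+ 2.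
  move=> [_ Fh]; rewrite /W -!mulmxA -(rdot_herm _ _ Fh) mulmxBl rdotDr rdotNr.
  by rewrite mul_scalar_mx rdotZr rdotvv.
exists (fun mu => spnorm (W (E mu) (B mu) - W E0 B0)).
  apply: (spcvgM (spcvgM cE (spcvgB cB _)) cE); exact: spcvg_cst.
apply: filterS hE => mu hE y Ey.
have h1 : rdot y (W (E mu) (B mu) *m y) = rdot y (B mu *m y) - a * cvnorm y ^+ 2.
  by rewrite rW // Ey.
have h2 : rdot y (W E0 B0 *m y) <= 0.
  by rewrite rW // subr_le0 ha // mulmxA hE0.1.
have h3 : rdot y ((W (E mu) (B mu) - W E0 B0) *m y) <=
    spnorm (W (E mu) (B mu) - W E0 B0) * cvnorm y ^+ 2.
  apply: le_trans (rdot_le _ _) _; rewrite mulrC expr2 mulrA.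
  apply: ler_wpM2r; [exact: cvnorm_ge0 | exact: le_spnorm].
rewrite mulrDl; move: h3; rewrite mulmxBl rdotDr rdotNr h1.
move: h2; move: (rdot y (W E0 B0 *m y)) (rdot y (B mu *m y)) (_ * _) (_ * _).
by clear=> x y z t; lra.
Qed.

Lemma numrange_ge_perturb (R : realType) (T : Type) (N : nat) (F : set_system T)
    {FF : Filter F} (E B : T -> 'M[R[i]]_N) (E0 B0 : 'M[R[i]]_N) (b : R) :
  orthoproj E0 -> (\forall mu \near F, orthoproj (E mu)) ->
  spcvg E F E0 -> spcvg B F B0 -> numrange_ge E0 B0 b ->
  exists2 e : T -> R, e @ F --> (0 : R) &
    \forall mu \near F, numrange_ge (E mu) (B mu) (b - e mu).
Proof.
move=> hE0 hE cE cB /numrange_geN hb.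
have [e e0 he] := numrange_le_perturb hE0 hE cE (spcvgN cB) hb.
exists e => //; apply: filterS he => mu he; apply/numrange_geN.
by rewrite opprB addrC.
Qed.

(** * The reference matrix and convergence of the minimizers *)

Lemma numrange_le_trans (R : realType) (N : nat) (E B : 'M[R[i]]_N) (a b : R) :
  a <= b -> numrange_le E B a -> numrange_le E B b.
Proof.
move=> ab h y /h; move/le_trans; apply; apply: ler_wpM2r => //; exact: sqr_ge0.
Qed.

Lemma numrange_le0 (R : realType) (N : nat) (B : 'M[R[i]]_N) (a : R) : numrange_le 0 B a.
Proof. by move=> y; rewrite mul0mx => <-; rewrite rdotC rdot0r cvnorm0 expr0n mulr0. Qed.

Lemma numrange_ge0 (R : realType) (N : nat) (B : 'M[R[i]]_N) (a : R) : numrange_ge 0 B a.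
Proof. by apply/numrange_geN; exact: numrange_le0. Qed.

Lemma eigenspace_vec (R : realType) (N : nat) (B : 'M[R[i]]_N) (z : 'cV_N) (a : R[i]) :
  (z^T <= eigenspace B^T a)%MS <-> B *m z = a *: z.
Proof.
split=> [/eigenspaceP h|h].
  by apply: trmx_inj; rewrite trmx_mul h linearZ.
by apply/eigenspaceP; rewrite -trmx_mul h linearZ.
Qed.

Lemma eigenvector_orth (R : realType) (N : nat) (B : 'M[R[i]]_N) (y z : 'cV_N) (a b : R) :
  B \is hermsymmx -> B *m y = a%:C *: y -> B *m z = b%:C *: z -> a != b -> rdot y z = 0.
Proof.
move=> hB By Bz ab; have : a * rdot y z = b * rdot y z.
  by rewrite -rdotZl -By rdot_herm // Bz rdotZr.
by move/eqP; rewrite -subr_eq0 -mulrBl mulf_eq0 subr_eq0 (negPf ab) => /eqP.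
Qed.

(** With a the K-th eigenvalue: an eigenvector in ran P whose eigenvalue is not one
    of the first K would be orthogonal to all their eigenspaces, hence to itself;
    an eigenvector in ran P^perp cannot belong to one of the first K eigenvalues. *)
Lemma spectral_separation (R : realType) (N : nat) (B P : 'M[R[i]]_N) (lam : seq R) (K : nat) :
  B \is hermsymmx -> distinct_eigenvalues B lam -> (0 < K)%N -> (K <= size lam)%N ->
  orthoproj P -> (P^T :=: first_eigenspaces B lam K)%MS -> B *m P = P *m B ->
  exists a b : R, [/\ a < b, numrange_le P B a & numrange_ge (perpmx P) B b].
Proof.
move=> hB [slam elam] K0 Ksz hP eP BP; have hP' := orthoproj_perp hP.
have [PP Ph] := hP; have [P'P PP'] := perpmx_mul0 hP.
have BP' : B *m perpmx P = perpmx P *m B.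
  by rewrite /perpmx mulmxBr mulmxBl BP mulmx1 mul1mx.
pose a := lam`_K.-1; have Ksz' : (K.-1 < size lam)%N by rewrite prednK.
have ha : numrange_le P B a.
  have [->|P0] := eqVneq P 0; first exact: numrange_le0.
  have [m [v [v0 Pv Bv]] hm] := max_restr_spectrum hP P0 hB.
  apply: numrange_le_trans hm.
  have {}Bv : B *m v = m%:C *: v by rewrite -Bv mulmxA -BP -mulmxA Pv.
  have : (v^T <= first_eigenspaces B lam K)%MS.
    by rewrite -eP -Pv trmx_mul submxMl.
  move=> /sub_sumsmxP[u vu].
  have [/existsP[j /eqP ->]|] := boolP [exists j : 'I_K, m == lam`_j].
    rewrite (lt_sorted_leq_nth 0 slam) ?inE //; last by rewrite (leq_trans (ltn_ord j)).
    by rewrite -ltnS prednK.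
  move/existsPn => hj; have : cvnorm v ^+ 2 = 0.
    rewrite -rdotvv; have {2}-> : v = \sum_j (u j *m eigenspace B^T (lam`_j)%:C)^T.
      by apply: trmx_inj; rewrite vu linear_sum; apply: eq_bigr => j _; rewrite /= trmxK.
    elim/big_ind: _ => [|x y hx hy|j _]; first exact: rdot0r.
      by rewrite rdotDr hx hy addr0.
    apply: (eigenvector_orth hB Bv _ (hj j)).
    by apply/eigenspace_vec; rewrite trmxK submxMl.
  by move/eqP; rewrite sqrf_eq0 => /eqP/cvnorm_eq0 v0'; rewrite v0' eqxx in v0.
have [P0|P0] := eqVneq (perpmx P) 0.
  exists a, (a + 1); split=> //; first by rewrite ltrDl.
  by rewrite P0; exact: numrange_ge0.
have [m [v [v0 Pv Bv]] hm] := min_restr_spectrum hP' P0 hB.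
have {}Bv : B *m v = m%:C *: v by rewrite -Bv mulmxA -BP' -mulmxA Pv.
exists a, m; split=> //.
have : eigenvalue B^T m%:C.
  apply/eigenvalueP; exists v^T; first by rewrite -trmx_mul Bv linearZ.
  by rewrite -trmx0 (inj_eq (@trmx_inj _ _ _)).
rewrite elam => /mapP[l /(nthP 0)[j jsz <-]] /complexI mj.
have [jK|Kj] := ltnP j K; last first.
  by rewrite mj /a (lt_sorted_ltn_nth 0 slam) ?inE // prednK.
have : (v^T <= P^T)%MS.
  rewrite eP; apply: (sumsmx_sup (Ordinal jK)) => //.
  by apply/eigenspace_vec; rewrite Bv mj.
move=> /submxP[L vL].
have vPL : v = P *m L^T by apply: trmx_inj; rewrite vL trmx_mul trmxK.
have PvE : P *m v = v by rewrite vPL mulmxA PP.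
by case/eqP: v0; rewrite -PvE -Pv mulmxA PP' mul0mx.
Qed.

(** Combine [trace_gap] for B0 with the minimality of Q for B: the excess of Q over P
    in tr(B0 X) is at most tr((B0 - B)(Q - P)). *)
Lemma rb_dist_bound (R : realType) (N m : nat) (B B0 V P Q : 'M[R[i]]_N) (a b : R) :
  B0 *m P = P *m B0 -> numrange_le P B0 a -> numrange_ge (perpmx P) B0 b -> a < b ->
  rb_admissible V m P -> rb_minimizer B V m Q ->
  (b - a) * spnorm (Q - P) ^+ 2 <= 2 * N%:R * spnorm (B - B0).
Proof.
move=> BP ha hb ab [hP trP PV] [[hQ trQ QV] Qmin].
have rk : \rank Q = \rank P.
  apply/eqP; rewrite -(@eqr_nat R[i]) -!orthoproj_rank_tr //.
  by rewrite trP trQ.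
have rQ : rtr Q = rtr P by rewrite /rtr trP trQ.
have h1 := trace_gap hP hQ rQ BP ha hb ab.
have h2 : rtr (B *m Q) <= rtr (B *m P).
  have : \tr (B *m Q) <= \tr (B *m P) by apply: Qmin; split.
  by rewrite lecE => /andP[_].
have h3 : rtr ((B0 - B) *m (Q - P)) <= 2 * N%:R * spnorm (B - B0).
  apply: le_trans (rtr_le _) _; rewrite [2 * _]mulrC -mulrA; apply: ler_wpM2l; first exact: ler0n.
  apply: le_trans (spnormM _ _) _; rewrite mulrC -(spnormN (B - B0)) opprB.
  apply: ler_wpM2r; first exact: spnorm_ge0.
  apply: le_trans (spnormD _ _) _; rewrite spnormN [leRHS](_ : 2 = 1 + 1) //.
  by apply: lerD; exact: spnorm_orthoproj.
have h4 : spnorm (Q - P) <= spnorm (perpmx P *m Q).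
  by rewrite -opprB spnormN; exact: proj_dist.
have h5 : spnorm (Q - P) ^+ 2 <= spnorm (perpmx P *m Q) ^+ 2.
  by rewrite lerXn2r ?nnegrE ?spnorm_ge0.
apply: le_trans (ler_wpM2l _ h5) _; first by rewrite subr_ge0 ltW.
apply: le_trans h1 _; apply: le_trans h3.
rewrite mulmxBr (mulmxBl B0 B Q) (mulmxBl B0 B P) !rtrD !rtrN rtrD rtrN.
move: h2; move: (rtr (B *m Q)) (rtr (B *m P)) (rtr (B0 *m Q)) (rtr (B0 *m P)).
by clear=> x y z t; lra.
Qed.

(** * Asymptotics at the reference point *)

(** Only upper semicontinuity of the factor is needed for the leading error term,
    so it suffices to bound the gap from below by a function that tends to its
    value at the limit.  If one of the limit projectors vanishes, so do the nearby
    ones, and all the factors equal 1. *)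
Lemma rb_factor_majorant (R : realType) (T : Type) (N : nat) (F : set_system T)
    {FF : Filter F} (B P Q : T -> 'M[R[i]]_N) (B0 P0 E : 'M[R[i]]_N) (a b : R) :
  B0 \is hermsymmx -> orthoproj P0 -> orthoproj (E - P0) -> E *m P0 = P0 ->
  numrange_le P0 B0 a -> numrange_ge (E - P0) B0 b -> a < b ->
  (\forall mu \near F, [/\ B mu \is hermsymmx, orthoproj (P mu),
     orthoproj (E - Q mu) & E *m Q mu = Q mu]) ->
  spcvg B F B0 -> spcvg P F P0 -> spcvg Q F P0 ->
  exists2 G : T -> R, G @ F --> rb_factor B0 P0 E P0 &
    \forall mu \near F, rb_factor (B mu) (P mu) E (Q mu) <= G mu.
Proof.
move=> hB0 hP0 hS0 EP0 ha hb ab hnear cB cP cQ.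
have Sperp X : E *m X = X -> E *m perpmx X = E - X.
  by move=> EX; rewrite /perpmx mulmxBr mulmx1 EX.
have cS : spcvg (fun mu => E - Q mu) F (E - P0) by apply: spcvgB cQ; exact: spcvg_cst.
have := @spectral_gapP _ _ B0 P0 E P0 a b hP0; rewrite (Sperp _ EP0).
move=> /(_ hS0 hB0 ha hb ab) [deg|[[a' b'] /andP[/= aa' bb'] [ha' hb' gap0]]].
  exists (fun=> 1).
    rewrite rb_factor_pinfty; first exact: cvg_cst.
    by apply: spectral_gap_pinfty; rewrite (Sperp _ EP0).
  have small (f : T -> 'M[R[i]]_N) (L : 'M[R[i]]_N) : L = 0 -> spcvg f F L ->
      \forall mu \near F, spnorm (f mu) < 1.
    move=> -> /cvgrPdist_lt /(_ 1 ltr01); apply: filterS => mu.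
    by rewrite sub0r normrN subr0 ger0_norm ?spnorm_ge0.
  have deg' : (\forall mu \near F, spnorm (P mu) < 1) \/
      (\forall mu \near F, spnorm (E - Q mu) < 1).
    by case: deg => z0; [left; exact: small cP | right; exact: small cS].
  have : \forall mu \near F, P mu = 0 \/ E *m perpmx (Q mu) = 0.
    case: deg' => hs; apply: filterS2 hs hnear => mu hs [_ hP hS EQ].
      by left; exact: orthoproj_small.
    by right; rewrite (Sperp _ EQ); exact: orthoproj_small.
  by apply: filterS => mu hz; rewrite rb_factor_pinfty //; exact: spectral_gap_pinfty.
have ab' : 0 < b' - a' by rewrite subr_gt0; exact: le_lt_trans aa' (lt_le_trans ab bb').
have nP : \forall mu \near F, orthoproj (P mu) by apply: filterS hnear => mu [].
have nS : \forall mu \near F, orthoproj (E - Q mu) by apply: filterS hnear => mu [].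
have [e1 e10 he1] := numrange_le_perturb hP0 nP cP cB ha'.
have [e2 e20 he2] := numrange_ge_perturb hS0 nS cS cB hb'.
pose h mu := b' - e2 mu - (a' + e1 mu).
have ch : h @ F --> (b' - a' : R).
  rewrite [X in _ --> X](_ : _ = b' - 0 - (a' + 0)); last by rewrite subr0 addr0.
  apply: cvgB; first by apply: cvgB => //; exact: cvg_cst.
  by apply: cvgD => //; exact: cvg_cst.
have h0 : \forall mu \near F, 0 < h mu by apply: (cvgr_gt _ ch).
exists (fun mu => Num.sqrt (1 + res2 (B mu) E / h mu ^+ 2)).
  rewrite (rb_factor_fin ab' gap0).
  apply: (@continuous_cvg _ _ _ F FF (fun mu => 1 + res2 (B mu) E / h mu ^+ 2) Num.sqrt).
    exact: sqrt_continuous.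
  apply: cvgD; first exact: cvg_cst.
  apply: cvgM.
    have cR : (fun mu => spnorm (E *m B mu *m perpmx E)) @ F --> (spnorm (E *m B0 *m perpmx E) : R).
      apply: (spcvg_norm (f := fun mu => E *m B mu *m perpmx E)).
      apply: (spcvgM (f := fun mu => E *m B mu) (g := fun=> perpmx E)); last exact: spcvg_cst.
      by apply: (spcvgM (f := fun=> E) (g := B)); [exact: spcvg_cst | exact: cB].
    by rewrite /res2; under eq_fun do rewrite expr2; rewrite expr2; exact: cvgM.
  apply: cvgV; first by rewrite expf_eq0 /= gt_eqF.
  by under eq_fun do rewrite expr2; rewrite expr2; exact: cvgM.
apply: filterS (filterI (filterI hnear h0) (filterI he1 he2)) => mu [[[hB hP hS EQ] hmu] [n1 n2]].
have := @spectral_gapP _ _ (B mu) (P mu) E (Q mu) (a' + e1 mu) (b' - e2 mu) hP.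
rewrite (Sperp _ EQ) => /(_ hS hB n1 n2); rewrite -subr_gt0 => /(_ hmu) [deg|].
  rewrite rb_factor_pinfty; last by apply: spectral_gap_pinfty; rewrite (Sperp _ EQ).
  rewrite -[leLHS]sqrtr1; apply: ler_wsqrtr; rewrite lerDl.
  by apply: mulr_ge0; rewrite ?invr_ge0; exact: sqr_ge0.
move=> [[x y] /andP[/= xa yb] [_ _ gapmu]].
have hxy : h mu <= y - x by apply: lerB.
rewrite (rb_factor_fin (lt_le_trans hmu hxy) gapmu); apply: ler_wsqrtr.
rewrite lerD2l; apply: ler_wpM2l; first exact: sqr_ge0.
have hxy0 := lt_le_trans hmu hxy.
rewrite lef_pV2 ?posrE ?exprn_gt0 //.
by rewrite lerXn2r ?nnegrE // ltW.
Qed.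

(** Only the term with p = 0 survives, since 0 ^+ 0 = 1. *)
Lemma tail_series0 (R : realType) (d N m : nat) (c : {ffun 'I_d -> nat} -> 'M[R[i]]_N) :
  tail_series c m 0 = coef_norm_sum c m.
Proof.
rewrite /tail_series; apply: cvg_lim => //; apply: cvg_near_cst.
near=> k; rewrite /series /=.
have k0 : (0 < k)%N by near: k; exact: nbhs_infty_ge.
rewrite big_ltn // expr0 mul1r add0n big_nat_cond big1 ?addr0 // => p.
by rewrite andbT => /andP[p0 _]; rewrite expr0n gtn_eqF // mul0r.
Unshelve. all: by end_near.
Qed.

(** The product of G = f0 + o(1) and c |x|^(n+1) + C |x|^(n+2) is
    f0 c |x|^(n+1) + w |x|^(n+1) with w --> 0. *)
Lemma asymptotic_estimate (R : realType) (d n : nat) (mu0 : 'rV[R]_d)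
    (err fac t G : 'rV[R]_d -> R) (f0 c C : R) :
  let rate mu : R^o := enorm (mu - mu0) ^+ n.+1 in
  0 <= c -> 0 <= C ->
  (\forall mu \near mu0, [/\ 0 <= err mu, 0 <= fac mu, err mu <= fac mu * t mu & fac mu <= G mu]) ->
  (\forall mu \near mu0, t mu <= c * rate mu + C * enorm (mu - mu0) ^+ n.+2) ->
  G @ mu0 --> f0 ->
  (err : 'rV[R]_d -> R^o) =O_mu0 rate /\
  exists2 e : 'rV[R]_d -> R^o, e =o_mu0 rate &
    \forall mu \near mu0, err mu <= f0 * c * rate mu + e mu.
Proof.
move=> rate c0 C0 hnear ht hG; have FF : Filter (nbhs mu0) := nbhs_filter mu0.
have rate0 mu : 0 <= rate mu by rewrite exprn_ge0 // enorm_ge0.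
have cen := @cvg_enorm R d mu0.
pose w mu := (G mu - f0) * c + G mu * C * enorm (mu - mu0).
have cw : w @ mu0 --> (0 : R).
  rewrite [X in _ --> X](_ : _ = (f0 - f0) * c + f0 * C * 0); last first.
    by rewrite subrr mul0r mulr0 addr0.
  apply: (@cvgD _ _ _ (nbhs mu0) FF).
    apply: (@cvgM _ _ (nbhs mu0) FF); last exact: (@cvg_cst _ c _ (nbhs mu0) FF).
    by apply: (@cvgB _ _ _ (nbhs mu0) FF) => //; exact: (@cvg_cst _ f0 _ (nbhs mu0) FF).
  apply: (@cvgM _ _ (nbhs mu0) FF) => //.
  by apply: (@cvgM _ _ (nbhs mu0) FF) => //; exact: (@cvg_cst _ C _ (nbhs mu0) FF).
have main : \forall mu \near mu0, 0 <= err mu <= f0 * c * rate mu + w mu * rate mu.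
  apply: filterS2 hnear ht => mu [e0 fac0 le_err hfG] tle; rewrite e0 /=.
  have bound0 : 0 <= c * rate mu + C * enorm (mu - mu0) ^+ n.+2.
    by apply: addr_ge0; apply: mulr_ge0 => //; rewrite exprn_ge0 // enorm_ge0.
  apply: le_trans le_err _; apply: le_trans (ler_wpM2l fac0 tle) _.
  apply: le_trans (ler_wpM2r bound0 hfG) _.
  rewrite /w exprSr -/(rate mu) le_eqVlt; apply/orP; left; apply/eqP.
  by move: (G mu) (rate mu) (enorm _) => x y z; ring.
have wle e : 0 < e -> \forall mu \near mu0, `|w mu| <= e.
  by move=> e0; move/(@cvgr0Pnorm_le _ _ _ (nbhs mu0) FF): cw => /(_ e e0).
split.
  apply/eqO_exP; exists (`|f0 * c| + 1); first by rewrite ltr_wpDl.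
  apply: filterS2 main (wle 1 ltr01) => mu /andP[e0 em] w1.
  rewrite (ger0_norm e0) (ger0_norm (rate0 mu)).
  apply: le_trans em _; rewrite -mulrDl; apply: ler_wpM2r => //.
  by apply: lerD; [exact: ler_norm | exact: le_trans (ler_norm _) w1].
exists (fun mu => w mu * rate mu).
  apply/eqoP => e e0; apply: filterS (wle e e0) => mu we.
  by rewrite normrM; exact: ler_wpM2r.
by apply: filterS main => mu /andP[].
Qed.

Lemma taylor_coef_sub (R : realType) (d N n p : nat)
    (c : {ffun 'I_d -> nat} -> 'M[R[i]]_N) (beta : {ffun 'I_d -> nat}) :
  (p <= n)%N -> beta \in mindex d p -> ((c beta)^T <= taylor_space c n)%MS.
Proof.
rewrite -ltnS => pn hb; apply: (sumsmx_sup (Ordinal pn)) => //=.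
by rewrite (bigD1_seq beta) ?uniq_mindex //= -(genmxE (c beta)^T) addsmxSl.
Qed.

Lemma perp_hom_part (R : realType) (d N n p : nat) (E : 'M[R[i]]_N)
    (c : {ffun 'I_d -> nat} -> 'M[R[i]]_N) (x : 'rV[R]_d) :
  orthoproj_onto E (taylor_space c n) -> (p <= n)%N -> perpmx E *m hom_part c p x = 0.
Proof.
move=> hE pn; rewrite /hom_part mulmx_sumr big_seq big1 // => beta hb.
rewrite -scalemxAr -(proj_absorb hE (taylor_coef_sub _ pn hb)) mulmxA.
by rewrite (perpmx_mul0 hE.1).1 mul0mx scaler0.
Qed.

(** E^perp annihilates the terms of degree at most n. *)
Lemma perp_analytic_le (R : realType) (d N n : nat) (f : 'rV[R]_d -> 'M[R[i]]_N)
    (mu0 : 'rV[R]_d) (c : {ffun 'I_d -> nat} -> 'M[R[i]]_N) (E : 'M[R[i]]_N) :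
  power_series_at f mu0 c -> orthoproj_onto E (taylor_space c n) ->
  exists2 C : R, 0 <= C & \forall mu \near mu0,
    spnorm (perpmx E *m f mu) <=
      coef_norm_sum c n.+1 * enorm (mu - mu0) ^+ n.+1 + C * enorm (mu - mu0) ^+ n.+2.
Proof.
move=> hf hE; have [C C0 hC] := taylor_remainder n.+2 hf; exists C => //.
have hE' := spnorm_orthoproj (orthoproj_perp hE.1).
apply: filterS hC => mu; set S := \sum_(_ <= p < _) _ => hC.
have eS : perpmx E *m S = perpmx E *m hom_part c n.+1 (mu - mu0).
  rewrite /S big_nat_recr //= mulmxDr mulmx_sumr big_nat_cond big1 ?add0r // => p.
  by rewrite andbT ltnS => /andP[_ pn]; exact: (perp_hom_part _ hE pn).
have -> : perpmx E *m f mu =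
    perpmx E *m hom_part c n.+1 (mu - mu0) + perpmx E *m (f mu - S).
  by rewrite -eS -mulmxDr addrC subrK.
have contract X : spnorm (perpmx E *m X) <= spnorm X.
  apply: le_trans (spnormM _ _) _; rewrite -[leRHS]mul1r.
  exact: ler_wpM2r (spnorm_ge0 X) _ _ hE'.
apply: le_trans (spnormD _ _) _; apply: lerD; last exact: le_trans (contract _) hC.
by apply: le_trans (contract _) _; rewrite mulrC; exact: hom_part_le.
Qed.

(** The squared distance is at most a multiple of |B - B0|. *)
Lemma rb_cvg (R : realType) (T : Type) (N m : nat) (F : set_system T) {FF : Filter F}
    (B Q : T -> 'M[R[i]]_N) (B0 V P : 'M[R[i]]_N) (a b : R) :
  B0 *m P = P *m B0 -> numrange_le P B0 a -> numrange_ge (perpmx P) B0 b -> a < b ->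
  rb_admissible V m P -> (\forall mu \near F, rb_minimizer (B mu) V m (Q mu)) ->
  spcvg B F B0 -> spcvg Q F P.
Proof.
move=> BP ha hb ab hP hQ cB; have ba : 0 < b - a by rewrite subr_gt0.
have h : (fun mu => Num.sqrt (2 * N%:R / (b - a) * spnorm (B mu - B0))) @ F --> (0 : R).
  rewrite -[X in _ --> X]sqrtr0.
  apply: (@continuous_cvg _ _ _ F FF (fun mu => _ * spnorm (B mu - B0)) Num.sqrt).
    exact: sqrt_continuous.
  rewrite -[X in _ --> X](mulr0 (2 * N%:R / (b - a))).
  by apply: cvgM; [exact: cvg_cst | exact: cB].
apply: cvg0_le h; apply: filterS hQ => mu /(rb_dist_bound BP ha hb ab hP) hd.
rewrite spnorm_ge0 /= -[leLHS]ger0_norm ?spnorm_ge0 // -sqrtr_sqr; apply: ler_wsqrtr.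
by rewrite mulrAC (ler_pdivlMr _ _ ba) mulrC.
Qed.

Theorem theorem4p3 (R : realType) (d N : nat)
    (D : set 'rV[R]_d) (mu0 : 'rV[R]_d) (A : 'rV[R]_d -> 'M[R[i]]_N)
    (lam : seq R) (K n : nat)
    (P : 'rV[R]_d -> 'M[R[i]]_N) (Pc : {ffun 'I_d -> nat} -> 'M[R[i]]_N)
    (Pi : 'M[R[i]]_N) (Qrb : 'rV[R]_d -> 'M[R[i]]_N)
    (D_open : open D) (D_mu0 : D mu0)
    (A_herm : forall mu, D mu -> A mu \is hermsymmx)
    (A_analytic : forall mu, D mu -> analytic_at A mu)
    (lamP : distinct_eigenvalues (A mu0) lam)
    (K_gt0 : (0 < K)%N) (K_le : (K <= size lam)%N)
    (P_proj : total_eigenprojector A mu0 lam K P)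
    (P_series : power_series_at P mu0 Pc)
    (Pi_proj : orthoproj_onto Pi (taylor_space Pc n))
    (QrbP : \forall mu \near mu0,
       rb_minimizer (A mu) (taylor_space Pc n) (total_mult (A mu0) lam K)
         (Qrb mu)) :
  let factor mu : R := rb_factor (A mu) (P mu) Pi (Qrb mu) in
  let err mu : R^o := spnorm (Qrb mu - P mu) in
  let rate mu : R^o := enorm (mu - mu0) ^+ n.+1 in
  [/\ (\forall mu \near mu0,
         err mu <= factor mu * spnorm (perpmx Pi *m P mu)),
      err =O_mu0 rate,
      exists2 e : 'rV[R]_d -> R^o, e =o_mu0 rate &
        (\forall mu \near mu0,
          err mu <= factor mu0 * tail_series Pc n.+1 0 * rate mu + e mu)
    & tail_series Pc n.+1 0 = \sum_(beta <- mindex d n.+1) spnorm (Pc beta)].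
Proof.
move=> factor err rate; have FF : Filter (nbhs mu0) := nbhs_filter mu0.
have nD : \forall mu \near mu0, A mu \is hermsymmx.
  by apply: filterS A_herm _; apply: open_nbhs_nbhs.
have hA0 := A_herm _ D_mu0.
have [c /analytic_spcvg [_ cA]] := A_analytic _ D_mu0.
have [P0E cP] := analytic_spcvg P_series.
have [eP nP] := P_proj; have [_ hP0 rk0 AP0] := nbhs_singleton nP.
have [a [b [ab ha hb]]] := spectral_separation hA0 lamP K_gt0 K_le hP0 eP AP0.
have hPi := Pi_proj.1.
have PiP0 : Pi *m P mu0 = P mu0.
  have := perp_hom_part 0 Pi_proj (leq0n n); rewrite -P0E /perpmx mulmxBl mul1mx.
  by move/eqP; rewrite subr_eq0 => /eqP.
have admP0 : rb_admissible (taylor_space Pc n) (total_mult (A mu0) lam K) (P mu0).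
  split=> //; first by rewrite orthoproj_rank_tr // rk0.
  by rewrite -PiP0 -Pi_proj.2 trmx_mul submxMl.
have cQ : spcvg Qrb (nbhs mu0) (P mu0) by exact: rb_cvg AP0 ha hb ab admP0 QrbP cA.
(* The estimate behind the convergence holds at mu0 itself, with a zero bound. *)
have Q0 : Qrb mu0 = P mu0.
  have := rb_dist_bound AP0 ha hb ab admP0 (nbhs_singleton QrbP).
  rewrite subrr spnorm0 mulr0 pmulr_rle0 ?subr_gt0 // => h.
  apply/eqP; rewrite -subr_eq0; apply/eqP/spnorm_eq0.
  have : spnorm (Qrb mu0 - P mu0) ^+ 2 == 0 by rewrite eq_le h sqr_ge0.
  by rewrite sqrf_eq0 => /eqP ->.
have hS0 := (orthoproj_sub hPi hP0 PiP0).1.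
(* ran (Pi - P mu0) is orthogonal to ran (P mu0). *)
have hb0 : numrange_ge (Pi - P mu0) (A mu0) b.
  move=> y Sy; apply: hb; rewrite /perpmx mulmxBl mul1mx -Sy mulmxA mulmxBr.
  by rewrite (orthoproj_sub hPi hP0 PiP0).2 hP0.1 subrr mul0mx subr0.
have nQ : \forall mu \near mu0, [/\ orthoproj (Qrb mu), Pi *m Qrb mu = Qrb mu,
    orthoproj (Pi - Qrb mu) & \rank (P mu) = \rank (Qrb mu)].
  apply: filterS2 QrbP nP => mu [[hQ trQ QV] _] [_ hP rkP _].
  have PiQ := proj_absorb Pi_proj QV.
  split; [exact: hQ | exact: PiQ | exact: (orthoproj_sub hPi hQ PiQ).1 |].
  by apply/eqP; rewrite -(@eqr_nat R[i]) -(orthoproj_rank_tr hQ) trQ rkP.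
have nall : \forall mu \near mu0, [/\ A mu \is hermsymmx, orthoproj (P mu),
    orthoproj (Pi - Qrb mu) & Pi *m Qrb mu = Qrb mu].
  by apply: filterS3 nD nP nQ => mu hA [_ hP _ _] [].
have nP' : \forall mu \near mu0, orthoproj (P mu) by apply: filterS nall => mu [].
have nS : \forall mu \near mu0, orthoproj (Pi - Qrb mu) by apply: filterS nall => mu [].
have cS : spcvg (fun mu => Pi - Qrb mu) (nbhs mu0) (Pi - P mu0).
  by apply: (spcvgB (f := fun=> Pi) (g := Qrb)); [exact: spcvg_cst | exact: cQ].
have [e1 e10 he1] := numrange_le_perturb hP0 nP' cP cA ha.
have [e2 e20 he2] := numrange_ge_perturb hS0 nS cS cA hb0.
have gap_pos : \forall mu \near mu0, a + e1 mu < b - e2 mu.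
  pose del := (b - a) / 2; have del0 : 0 < del by rewrite divr_gt0 ?subr_gt0.
  apply: filterS2 (cvgr_lt 0 e10 del del0) (cvgr_lt 0 e20 del del0) => mu.
  by rewrite /del; move: (e1 mu) (e2 mu) => x y; clear; lra.
have bound : \forall mu \near mu0, err mu <= factor mu * spnorm (perpmx Pi *m P mu).
  apply: filterS3 (filterI nall nQ) (filterI nP QrbP) (filterI gap_pos (filterI he1 he2)).
  move=> mu [[hA hP hS PiQ] [hQ _ _ rk]] [[_ _ _ AP] minQ] [gmu [n1 n2]].
  exact: rb_error_bound hP hQ hPi hA rk AP PiQ hS (minimizer_stationary hA Pi_proj minQ) n1 n2 gmu.
have [C C0 hC] := perp_analytic_le P_series Pi_proj.
have [G hG leG] := rb_factor_majorant hA0 hP0 hS0 PiP0 ha hb0 ab nall cA cP cQ.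
have [] := @asymptotic_estimate R d n mu0 err factor
  (fun mu => spnorm (perpmx Pi *m P mu)) G (factor mu0) (coef_norm_sum Pc n.+1) C
  (coef_norm_sum_ge0 _ _) C0.
- apply: filterS2 bound leG => mu hmu leG.
  by split=> //; [exact: spnorm_ge0 | exact: sqrtr_ge0].
- exact: hC.
- by rewrite /factor Q0.
move=> hO hlead; split=> //; rewrite tail_series0 //; exact: hlead.
Qed.
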